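(* Let $G=SL_2(\mathbb{R})$ and $m\in\mathbb{R}$. The slice $\Sigma_m$ for the maximal adapted complexification $\Omega_m$ consists of the elements $(e,uU+aH)\in\Sigma$ ($u\in\mathbb{R}$, $a\ge 0$) such that $$( * )\quad 4u^2m^2-4a^2>-\pi^2\qquad\text{and}\qquad( ** )\quad 4u^2m^2+4ma^2<f(4u^2m^2-4a^2),$$ where $f(x):=\dfrac{x\,C(x)}{C(x)-S(x)}=\dfrac{C(x)}{2S'(x)}$.
   Context: $C,S:\mathbb{R}\to\mathbb{R}$ are the real-analytic functions $C(x)=\cosh\sqrt{x}$ and $S(x)=\sinh\sqrt{x}/\sqrt{x}$ (restrictions to $\mathbb{R}$ of the entire functions $\cosh\sqrt z$, $\sinh\sqrt z/\sqrt z$; so $C(x)=\cos\sqrt{-x}$, $S(x)=\sin\sqrt{-x}/\sqrt{-x}$ for $x<0$). They satisfy $S'(x)=\frac{C(x)-S(x)}{2x}$, and $S'>0$ for $x>-\pi^2$; $f$ is only evaluated at $x>-\pi^2$. In $\mathfrak{g}=\mathfrak{sl}_2(\mathbb{R})$ let $U=\begin{pmatrix}0&-1\\1&0\end{pmatrix}$, $H=\begin{pmatrix}1&0\\0&-1\end{pmatrix}$, $W=\begin{pmatrix}0&1\\1&0\end{pmatrix}$; $\mathfrak{k}=\mathbb{R}U$, $\mathfrak{p}=\mathbb{R}H\oplus\mathbb{R}W$, $K=SO_2(\mathbb{R})$, $\mathfrak{a}^+=\{aH: a\ge0\}$, $G^{\mathbb{C}}=SL_2(\mathbb{C})$. Write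 $X=X_{\mathfrak{k}}+X_{\mathfrak{p}}$. Put $\Sigma=\{(e,X)\in G\times\mathfrak{g}: X_{\mathfrak{p}}\in\mathfrak{a}^+\}=\{(e,uU+aH):u\in\mathbb{R},a\ge0\}$ and $$P_m:G\times\mathfrak{g}\to SL_2(\mathbb{C}),\quad P_m(g,X)=g\exp\big(i(-mX_{\mathfrak{k}}+X_{\mathfrak{p}})\big)\exp\big(i(1+m)X_{\mathfrak{k}}\big).$$ $\Sigma_m$ is the connected component of $(e,0)$ in the set of points of $\Sigma$ at which the differential of $P_m$ is non-singular. The group $L=G\times K$ acts on $TG\cong G\times\mathfrak{g}$ by $(g,k)\cdot(g',X)=(gg'k^{-1},\mathrm{Ad}_kX)$, and $\Omega_m=L\cdot\Sigma_m$ is the maximal complexification in $TG$ adapted to the connection associated to the left-invariant metric $\nu_m|_{\mathfrak g}(X,Y)=-mB(X_{\mathfrak{k}},Y_{\mathfrak{k}})+B(X_{\mathfrak{p}},Y_{\mathfrak{p}})$, $B$ the Killing form. *)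

(* Defs.v *)
From HB Require Import structures.
From mathcomp Require Import all_boot all_order all_algebra.
From mathcomp Require Import complex.
From mathcomp Require Import all_classical all_reals all_analysis.

Set Implicit Arguments.
Unset Strict Implicit.
Unset Printing Implicit Defensive.

Import Order.TTheory GRing.Theory Num.Theory.
Import numFieldNormedType.Exports.

Local Open Scope classical_set_scope.
Local Open Scope ring_scope.
Local Open Scope complex_scope.

Definition cosh {R : realType} (t : R) : R := (expR t + expR (- t)) / 2.
Definition sinh {R : realType} (t : R) : R := (expR t - expR (- t)) / 2.

Definition Cfun {R : realType} (x : R) : R :=
  if 0 <= x then cosh (Num.sqrt x) else cos (Num.sqrt (- x)).

Definition Sfun {R : realType} (x : R) : R :=
  if 0 < x then sinh (Num.sqrt x) / Num.sqrt x
  else if x == 0 then 1 else sin (Num.sqrt (- x)) / Num.sqrt (- x).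

(* For x != 0 this is x C(x) / (C(x) - S(x)), a quotient which is 0 / 0 at
   x = 0; the form C / (2 S') is also meaningful there. *)
Definition fCS {R : realType} (x : R) : R := Cfun x / (2 * derive1 Sfun x).

Definition mxU {R : realType} : 'M[R]_2 := delta_mx 1 0 - delta_mx 0 1.
Definition mxH {R : realType} : 'M[R]_2 := delta_mx 0 0 - delta_mx 1 1.
Definition mxW {R : realType} : 'M[R]_2 := delta_mx 0 1 + delta_mx 1 0.

Definition sl2 {K : comNzRingType} : set 'M[K]_2 := [set X | \tr X = 0].

(* Components of X along k = R U and p = R H + R W. On a matrix which is not
   traceless, the scalar component is discarded. *)
Definition kproj {R : realType} (X : 'M[R]_2) : 'M[R]_2 :=
  ((X 1 0 - X 0 1) / 2) *: mxU.
Definition pproj {R : realType} (X : 'M[R]_2) : 'M[R]_2 :=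
  ((X 0 0 - X 1 1) / 2) *: mxH + ((X 0 1 + X 1 0) / 2) *: mxW.

Definition a_plus {R : realType} : set 'M[R]_2 :=
  [set a *: mxH | a in [set a : R | 0 <= a]].

Definition expmx {K : numFieldType} (A : 'M[K]_2) : 'M[K]_2 :=
  limn (series (fun n : nat => (n`!%:R)^-1 *: A ^+ n)).

Definition complexify {R : realType} (A : 'M[R]_2) : 'M[R[i]]_2 :=
  map_mx (real_complex R) A.

(* The identification of M_2(C) with the real normed space M_2(R) x M_2(R). *)
Definition realify {R : realType} (A : 'M[R[i]]_2) : 'M[R]_2 * 'M[R]_2 :=
  (map_mx (@complex.Re R) A, map_mx (@complex.Im R) A).

(* P_m, given by its formula on all of M_2(R) x M_2(R), which contains the
   submanifold SL_2(R) x sl_2(R) of interest. *)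
Definition Pmap {R : realType} (m : R) (p : 'M[R]_2 * 'M[R]_2) : 'M[R[i]]_2 :=
  complexify p.1
  *m expmx ('i%C *: complexify (- m *: kproj p.2 + pproj p.2))
  *m expmx ('i%C *: complexify ((1 + m) *: kproj p.2)).

Definition tangentSL2 {K : comNzRingType} (g : 'M[K]_2) : set 'M[K]_2 :=
  [set g *m Z | Z in sl2].

Definition tangent_Gg {R : realType} (p : 'M[R]_2 * 'M[R]_2) :
    set ('M[R]_2 * 'M[R]_2) :=
  tangentSL2 p.1 `*` sl2.

(* The differential of P_m : G x g -> SL_2(C) at p is the restriction of the
   differential of the ambient map to the tangent space of G x g at p; it is
   non-singular when it is an isomorphism onto the tangent space of SL_2(C)
   at P_m(p). *)
Definition nonsingular_at {R : realType} (m : R) (p : 'M[R]_2 * 'M[R]_2) :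
    Prop :=
  set_bij (tangent_Gg p) (realify @` tangentSL2 (Pmap m p))
    ('d (realify \o Pmap m) p).

Definition Sigma {R : realType} : set ('M[R]_2 * 'M[R]_2) :=
  [set p | [/\ p.1 = 1%:M, sl2 p.2 & a_plus (pproj p.2)]].

Definition Sigma_m {R : realType} (m : R) : set ('M[R]_2 * 'M[R]_2) :=
  connected_component (Sigma `&` [set p | nonsingular_at m p]) (1%:M, 0).

(* Main.v *)
(* For Y in sl_2(R) one has Y^2 = - det Y, so exp(iY) = C(det Y) + i S(det Y) Y
   and P_m becomes an explicit differentiable map. At (e, uU + aH), multiplying
   the derivative of P_m on the right by the inverse of its value yields
   (Z, X) |-> Z + Q(X) with Z, Re Q(X) and Im Q(X) in sl_2(R); hence it is
   non-singular exactly when X |-> Im Q(X) is invertible on sl_2(R). With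
   x = 4 u^2 m^2 - 4 a^2, the determinant of the latter is
   S(x) (S(x) - 8 (1 + m) a^2 S'(x)). On x > - pi^2 both S and S' are positive,
   and the positivity of the second factor is condition ( ** ).
   On a connected set of non-singular points x avoids - pi^2, a zero of S, and
   the second factor avoids 0, so both keep their sign. Conversely the region
   is star-shaped about (e, 0): t S'(t x) / S(t x) is nondecreasing on [0, 1],
   by the Turan-type inequality 2 C S' <= S^2. *)

Require Import Defs.
From HB Require Import structures.
From mathcomp Require Import all_boot all_order all_algebra.
From mathcomp Require Import complex.
From mathcomp Require Import all_classical all_reals all_analysis.
From mathcomp Require Import ring lra.

Set Implicit Arguments.
Unset Strict Implicit.
Unset Printing Implicit Defensive.

Import Order.TTheory GRing.Theory Num.Theory.
Import numFieldNormedType.Exports.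

Local Open Scope classical_set_scope.
Local Open Scope ring_scope.

(** * The functions C and S *)

Section PowerSeries.
Variable R : realType.
Implicit Types (c : R^nat) (x : R).

(** Comparison with the exponential series gives convergence everywhere, and since (n+1)/(n+1)! =
    1/n! the condition passes to the formal derivative: one hypothesis covers all derivatives. *)
Definition fact_bounded c := forall n, 0 <= c n <= n`!%:R^-1.

Definition psum c x : R := limn (pseries c x).

Lemma fact_bounded_diffs c : fact_bounded c -> fact_bounded (pseries_diffs c).
Proof.
move=> hc n; have /andP[c0 c1] := hc n.+1.
rewrite /pseries_diffs mulr_ge0//=; apply: le_trans (ler_wpM2l (ler0n _ _) c1) _.
by rewrite factS natrM invfM mulVKf.
Qed.

Lemma is_cvg_pseries_fact c x : fact_bounded c -> cvgn (pseries c x).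
Proof.
move=> hc; apply: normed_cvg; rewrite /normed_series_of /=.
apply: series_le_cvg (is_cvg_series_exp_coeff `|x|) => n //=.
  by rewrite /exp_coeff /= divr_ge0.
have /andP[c0 c1] := hc n.
by rewrite /exp_coeff /= normrM normrX mulrC ler_wpM2l// ger0_norm.
Qed.

Lemma is_derive_psum c x : fact_bounded c ->
  is_derive x (1 : R) (psum c) (psum (pseries_diffs c) x).
Proof.
move=> hc; have hc1 := fact_bounded_diffs hc.
have hc2 := fact_bounded_diffs hc1.
(* Any radius beyond [|x|] serves; the series and its first two formal derivatives converge
   there. *)
apply: (@pseries_snd_diffs _ c (`|x| + 1)); try exact: is_cvg_pseries_fact.
by rewrite [ltRHS]ger0_norm ?ltrDl// addr_ge0.
Qed.

Lemma continuous_psum c : fact_bounded c -> continuous (psum c).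
Proof.
move=> hc x; apply/differentiable_continuous/derivable1_diffP.
by have := is_derive_psum x hc => h; exact: ex_derive.
Qed.

Lemma psum0 c : psum c 0 = c 0%N.
Proof.
rewrite /psum; apply: lim_near_cst => //; near=> n.
rewrite -[n]prednK; last by near: n.
rewrite /pseries /series /= big_nat_recl//= expr0 mulr1 big1 ?addr0// => i _.
by rewrite expr0n mulr0.
Unshelve. all: by end_near. Qed.

(** The operator x d/dx multiplies the n-th coefficient by n; in this form coefficients are compared
    without an index shift. *)
Lemma mul_psum_diffs c x : fact_bounded c ->
  series (fun n => n%:R * c n * x ^+ n) @ \oo --> x * psum (pseries_diffs c) x.
Proof.
move=> hc; have hcv : cvgn (pseries (pseries_diffs c) x).
  exact/is_cvg_pseries_fact/fact_bounded_diffs.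
apply: (@cvg_trans _ _ _ _ _ (cvgM (cvg_cst x) (pseries_diffs_equiv hcv))).
apply: near_eq_cvg; near=> N.
rewrite /series /= mulr_sumr; apply: eq_bigr => -[|i] _.
  by rewrite !mul0r mulr0.
by rewrite /= exprS; ring.
Unshelve. all: by end_near. Qed.

End PowerSeries.

(** * C and S as power series, their derivatives and functional identities *)

Section CSFunctions.
Variable R : realType.
Implicit Types x : R.

(** Taylor coefficients at 0 of C and, below, of S: the square roots and the case distinction on the
    sign of x disappear. *)
Definition Ccoef (n : nat) : R := (n.*2`!%:R)^-1.
Definition Scoef (n : nat) : R := (n.*2.+1`!%:R)^-1.

Lemma fact_bounded_Ccoef : fact_bounded Ccoef.
Proof.
move=> n; rewrite /Ccoef invr_ge0 ler0n /= lef_pV2 ?posrE ?ltr0n ?fact_gt0//.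
by rewrite ler_nat leq_fact// -addnn leq_addr.
Qed.

Lemma fact_bounded_Scoef : fact_bounded Scoef.
Proof.
move=> n; rewrite /Scoef invr_ge0 ler0n /= lef_pV2 ?posrE ?ltr0n ?fact_gt0//.
by rewrite ler_nat leq_fact// -addnn leqW// leq_addr.
Qed.

(** Terms 2n and 2n+1 of (exp r + e exp(-r)) / 2 are paired: for e = 1 only the even one survives,
    for e = -1 only the odd one. *)
Lemma exp_coeff_group (e r : R) (n : nat) :
  \sum_(n * 2 <= i < n.+1 * 2)
    (2^-1 *: (exp_coeff r + e *: exp_coeff (- r))) i =
  (1 + e) / 2 * (r ^+ n.*2 / n.*2`!%:R)
  + (1 - e) / 2 * (r ^+ n.*2.+1 / n.*2.+1`!%:R).
Proof.
rewrite !muln2 doubleS big_ltn ?leqnSn// big_ltn// big_geq// addr0.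
rewrite -[LHS]/(2^-1 * (r ^+ n.*2 / n.*2`!%:R + e * ((- r) ^+ n.*2 / n.*2`!%:R))
  + 2^-1 * (r ^+ n.*2.+1 / n.*2.+1`!%:R
            + e * ((- r) ^+ n.*2.+1 / n.*2.+1`!%:R))).
have -> : (- r) ^+ n.*2.+1 = - r ^+ n.*2.+1.
  by rewrite !exprS -mul2n exprM sqrrN -exprM mulNr.
have -> : (- r) ^+ n.*2 = r ^+ n.*2 by rewrite -mul2n exprM sqrrN -exprM.
move: (n.*2.+1`!%:R^-1) (n.*2`!%:R^-1) (r ^+ n.*2.+1) (r ^+ n.*2) => a b c d.
by field.
Qed.

Lemma cvg_cosh (r : R) :
  series (fun n => r ^+ n.*2 / n.*2`!%:R) @ \oo --> cosh r.
Proof.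
have h := is_cvg_series_exp_coeff r; have h' := is_cvg_series_exp_coeff (- r).
have h1 := is_cvg_seriesZ (k := 1) h'.
have hs := is_cvg_seriesD h h1.
have hs2 := is_cvg_seriesZ (k := 2^-1) hs.
have := cvg_series_cvg_series_group hs2 (isT : (0 < 2)%N).
have -> : limn (series (2^-1 *: (exp_coeff r + 1 *: exp_coeff (- r)))) = cosh r.
  by rewrite lim_seriesZ// lim_seriesD// lim_seriesZ// /cosh mulrC scale1r.
apply: cvg_trans; apply: near_eq_cvg; near=> N.
rewrite /series /=; apply: eq_bigr => n _.
by rewrite exp_coeff_group subrr !mul0r addr0; field.
Unshelve. all: by end_near. Qed.

Lemma cvg_sinh (r : R) :
  series (fun n => r ^+ n.*2.+1 / n.*2.+1`!%:R) @ \oo --> sinh r.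
Proof.
have h := is_cvg_series_exp_coeff r; have h' := is_cvg_series_exp_coeff (- r).
have h1 := is_cvg_seriesZ (k := -1) h'.
have hs := is_cvg_seriesD h h1.
have hs2 := is_cvg_seriesZ (k := 2^-1) hs.
have := cvg_series_cvg_series_group hs2 (isT : (0 < 2)%N).
have -> : limn (series (2^-1 *: (exp_coeff r + (-1) *: exp_coeff (- r)))) = sinh r.
  by rewrite lim_seriesZ// lim_seriesD// lim_seriesZ// /sinh mulrC scaleN1r.
apply: cvg_trans; apply: near_eq_cvg; near=> N.
rewrite /series /=; apply: eq_bigr => n _.
by rewrite exp_coeff_group subrr !mul0r add0r; field.
Unshelve. all: by end_near. Qed.

(** Turns a series in r = sqrt |x| into a power series in x; the factor k is 1 for C and 1/r for S,
    whose series in r has odd powers. *)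
Lemma psum_lim (c u : R^nat) (x l k : R) :
  (forall n, c n * x ^+ n = u n * k) -> series u @ \oo --> l ->
  psum c x = l * k.
Proof.
move=> cu ul; rewrite /psum.
have -> : pseries c x = (fun n => series u n * k).
  apply/funext => n; rewrite /pseries /series /= mulr_suml.
  by apply: eq_bigr => i _; exact: cu.
by apply/cvg_lim => //; exact: cvgM ul (cvg_cst _).
Qed.

(** For x < 0 the alternating signs of the cosine series are those of x^n = (-1)^n sqrt(-x)^(2n), so
    both branches have the same power series. *)
Lemma CfunE : Cfun = psum Ccoef.
Proof.
apply/funext => x; rewrite /Cfun; apply/esym; case: leP => x0.
  rewrite (psum_lim (k := 1) _ (@cvg_cosh (Num.sqrt x))) ?mulr1// => n.
  by rewrite -mul2n exprM sqr_sqrtr// /Ccoef mul2n mulr1 mulrC.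
rewrite (psum_lim (k := 1) _ (@cvg_cos_coeff' _ (Num.sqrt (- x)))) ?mulr1// => n.
rewrite /cos_coeff' -mul2n exprM sqr_sqrtr ?oppr_ge0 ?ltW// /Ccoef mul2n.
by rewrite -exprnP -exprMn mulN1r opprK mulr1 mulrC.
Qed.

Lemma SfunE : Sfun = psum Scoef.
Proof.
apply/funext => x; rewrite /Sfun; case: (ltgtP x 0) => x0; last first.
- by rewrite x0 psum0 /Scoef /= invr1.
- have r0 : Num.sqrt x != 0 by rewrite sqrtr_eq0 -ltNge.
  rewrite (psum_lim (k := (Num.sqrt x)^-1) _ (@cvg_sinh (Num.sqrt x)))// => n.
  rewrite exprSr -mul2n exprM sqr_sqrtr ?ltW// /Scoef mul2n mulrC.
  by rewrite mulrAC mulfK.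
- have r0 : Num.sqrt (- x) != 0 by rewrite sqrtr_eq0 -ltNge oppr_gt0.
  rewrite (psum_lim (k := (Num.sqrt (- x))^-1) _ (@cvg_sin_coeff' _ (Num.sqrt (- x))))// => n.
  rewrite /sin_coeff' exprSr -mul2n exprM sqr_sqrtr ?oppr_ge0 ?ltW// /Scoef.
  by rewrite mul2n -exprnP mulrA -exprMn mulN1r opprK mulrC mulrAC mulfK.
Qed.

(** (n+1)/(2n+2)! = 1/(2 (2n+1)!), which is C' = S/2 on coefficients. *)
Lemma diffs_Ccoef : pseries_diffs Ccoef = 2^-1 *: Scoef.
Proof.
apply/funext => n; rewrite /pseries_diffs /Ccoef /Scoef doubleS factS natrM.
rewrite invfM mulrA -[RHS]/(2^-1 * _); congr (_ * _).
by rewrite -doubleS -mul2n natrM invfM mulrCA divff ?mulr1// pnatr_eq0.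
Qed.

Definition dSfun : R -> R := psum (pseries_diffs Scoef).

Lemma is_derive_Cfun x : is_derive x 1 Cfun (Sfun x / 2).
Proof.
rewrite CfunE SfunE; apply: is_derive_eq (is_derive_psum x fact_bounded_Ccoef) _.
have := is_cvg_pseries_fact (x := x) fact_bounded_Scoef.
rewrite diffs_Ccoef => /(@lim_seriesZ _ _ 2^-1) h; rewrite [RHS]mulrC -[RHS]h.
congr (limn _); apply/funext => n; apply: eq_bigr => i _ /=.
by rewrite -scalerAl.
Qed.

Lemma is_derive_Sfun x : is_derive x 1 Sfun (dSfun x).
Proof. by rewrite SfunE; exact: is_derive_psum fact_bounded_Scoef. Qed.

Lemma derive1_Sfun x : derive1 Sfun x = dSfun x.
Proof. by rewrite derive1E; have [] := is_derive_Sfun x. Qed.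

(** On coefficients this is 2n/(2n+1)! = 1/(2n)! - 1/(2n+1)!. *)
Lemma mulr_dSfun x : 2 * x * dSfun x = Cfun x - Sfun x.
Proof.
have hS := is_cvg_pseries_fact (x := x) fact_bounded_Scoef.
have hC := is_cvg_pseries_fact (x := x) fact_bounded_Ccoef.
rewrite CfunE SfunE /psum -lim_seriesB//.
rewrite -mulrA; apply/esym/cvg_lim => //; rewrite /dSfun.
have h := @mul_psum_diffs R _ x fact_bounded_Scoef.
have h2 : (fun n => 2 * series (fun n => n%:R * Scoef n * x ^+ n) n) @ \oo
    --> 2 * (x * psum (pseries_diffs Scoef) x) by exact: cvgM (cvg_cst _) h.
apply: cvg_trans h2.
apply: near_eq_cvg; near=> N.
rewrite /series /= mulr_sumr; apply: eq_bigr => n _.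
rewrite -[RHS]/(Ccoef n * x ^+ n - Scoef n * x ^+ n) -mulrBl !mulrA.
congr (_ * _); rewrite /Ccoef /Scoef factS natrM invfM.
have : (n.*2`!%:R : R) != 0 by rewrite pnatr_eq0 -lt0n fact_gt0.
have : (n.*2.+1%:R : R) != 0 by rewrite pnatr_eq0.
rewrite -mul2n -natr1 natrM; move: (_`!%:R : R) (n%:R : R) => a b.
by move=> b0 a0; field; apply/andP.
Unshelve. all: by end_near. Qed.

Lemma MVT_derive (f df : R -> R) (a b : R) : a < b ->
  (forall x, a <= x <= b -> is_derive x 1 f (df x)) ->
  exists2 c, a < c < b & f b - f a = df c * (b - a).
Proof.
move=> ab dfE.
have [||c] := @MVT R f df a b ab.
- by move=> x; rewrite in_itv /= => /andP[ax xb]; apply: dfE; rewrite !ltW.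
- apply: derivable_within_continuous => x; rewrite in_itv /= => xab.
  by have [] := dfE x xab.
- by rewrite in_itv /= => cab; exists c.
Qed.

Lemma Cfun0 : Cfun 0 = 1 :> R.
Proof. by rewrite CfunE psum0 /Ccoef invr1. Qed.

Lemma Sfun0 : Sfun 0 = 1 :> R.
Proof. by rewrite SfunE psum0 /Scoef invr1. Qed.

Definition ddSfun : R -> R := psum (pseries_diffs (pseries_diffs Scoef)).

Lemma is_derive_dSfun x : is_derive x 1 dSfun (ddSfun x).
Proof. exact/is_derive_psum/fact_bounded_diffs/fact_bounded_Scoef. Qed.

(** Derivative of 2 x S' = C - S, with C' = S/2. *)
Lemma mulr_ddSfun x : 2 * x * ddSfun x = Sfun x / 2 - 3 * dSfun x.
Proof.
have h1 := is_derive_dSfun x; have h2 := is_derive_Sfun x.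
have h3 := is_derive_Cfun x; have h4 := is_derive_id x (1 : R).
have E : (fun y => 2 * (y * dSfun y)) = Cfun - Sfun.
  by apply/funext => y; rewrite mulrA mulr_dSfun.
have d1 : is_derive x 1 (Cfun - Sfun) (Sfun x / 2 - dSfun x).
  exact: is_deriveB.
have d2 : is_derive x 1 (fun y => 2 * (y * dSfun y))
   (2 * (x * ddSfun x + dSfun x * 1)).
  exact: (is_deriveZ 2).
rewrite E in d2; have := derive_val (is_derive := d2).
rewrite (derive_val (is_derive := d1)) => e.
by lra.
Qed.

(** cosh^2 - sinh^2 = 1 for x > 0 and cos^2 + sin^2 = 1 for x < 0, where x S^2 is sinh^2 or -
    sin^2. *)
Lemma CfunSfun_unit x : Cfun x ^+ 2 - x * Sfun x ^+ 2 = 1.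
Proof.
rewrite /Cfun /Sfun; case: (ltgtP x 0) => x0; last first.
- by rewrite x0 mul0r subr0 sqrtr0 /cosh oppr0 expR0; field.
- rewrite -[X in X * _](sqr_sqrtr (ltW x0)); set r := Num.sqrt x.
  have r0 : r != 0 by rewrite sqrtr_eq0 -ltNge.
  have e0 : expR r != 0 by rewrite gt_eqF// expR_gt0.
  by rewrite /cosh /sinh expRN; field; rewrite r0.
- have nx : 0 <= - x by rewrite oppr_ge0 ltW.
  rewrite -[X in X * _]opprK -[X in - X * _](sqr_sqrtr nx).
  set r := Num.sqrt (- x).
  have r0 : r != 0 by rewrite sqrtr_eq0 -ltNge oppr_gt0.
  rewrite exprMn exprVn mulNr opprK mulrCA mulfV ?mulr1 ?cos2Dsin2//.
  by rewrite sqrf_eq0.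
Qed.

(** Double-angle formula for sinh or sin, as sqrt(4x) = 2 sqrt x. It passes from the determinant q
    of the exponent to the variable x = 4q of the theorem. *)
Lemma Sfun_double x : Sfun (4 * x) = Cfun x * Sfun x.
Proof.
have s4 y : Num.sqrt (4 * y) = 2 * Num.sqrt y.
  by rewrite sqrtrM// (_ : 4 = 2 ^+ 2) ?sqrtr_sqr ?ger0_norm//; ring.
have E : (0 < 4 * x) = (0 < x) by rewrite pmulr_rgt0.
have E' : (4 * x == 0) = (x == 0) by rewrite mulf_eq0 pnatr_eq0.
rewrite /Cfun /Sfun E E' -mulrN !s4; case: (ltgtP x 0) => x0; last first.
- by rewrite x0 sqrtr0 /cosh oppr0 expR0; field.
- set r := Num.sqrt x; have r0 : r != 0 by rewrite sqrtr_eq0 -ltNge.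
  have e0 : expR r != 0 by rewrite gt_eqF// expR_gt0.
  have -> : sinh (2 * r) = 2 * (cosh r * sinh r).
    rewrite /cosh /sinh !expRN (_ : 2 * r = r + r) ?expRD; last by ring.
    by field.
  by field.
- set r := Num.sqrt (- x).
  have r0 : r != 0 by rewrite sqrtr_eq0 -ltNge oppr_gt0.
  rewrite mulr_natl sin_mulr2n -mulr_natl.
  by field.
Qed.

(** * Positivity of S and S', the Turan-type inequality and its consequence along rays *)

Lemma Sfun_gt0 x : - pi ^+ 2 < x -> 0 < Sfun x.
Proof.
move=> hx; rewrite /Sfun; case: (ltgtP x 0) => x0 //.
- have r0 : 0 < Num.sqrt (- x) by rewrite sqrtr_gt0 oppr_gt0.
  rewrite divr_gt0// sin_gt0_pi// r0 /=.
  rewrite -(ger0_norm (pi_ge0 R)) -sqrtr_sqr ltr_sqrt ?exprn_gt0 ?pi_gt0//.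
  by lra.
- have r0 : 0 < Num.sqrt x by rewrite sqrtr_gt0.
  by rewrite divr_gt0// /sinh divr_gt0// subr_gt0 ltr_expR; lra.
Qed.

Lemma Sfun_Npi2 : Sfun (- pi ^+ 2) = 0 :> R.
Proof.
have h : (0 : R) < pi ^+ 2 by rewrite exprn_gt0// pi_gt0.
rewrite /Sfun ltNge (_ : - pi ^+ 2 <= 0)/=; last lra.
rewrite oppr_eq0 gt_eqF// opprK sqrtr_sqr ger0_norm ?pi_ge0//.
by rewrite sinpi mul0r.
Qed.

(* [t ^ 3 * S' (t ^ 2 x)] has derivative [t ^ 2 * S (t ^ 2 x) / 2] in [t]. *)
Lemma dSfun_gt0 x : - pi ^+ 2 < x -> 0 < dSfun x.
Proof.
move=> hx; pose h (t : R) := t ^+ 3 * dSfun (t ^+ 2 * x).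
have dh (t : R) : is_derive t 1 h (t ^+ 2 * Sfun (t ^+ 2 * x) / 2).
  have d1 := is_derive_dSfun (t ^+ 2 * x).
  have d2 : is_derive t 1 (fun t => t ^+ 2 * x) (2 * t * x).
    apply: is_derive_eq; rewrite /GRing.scale /=; ring.
  have d3 : is_derive t 1 (fun t => dSfun (t ^+ 2 * x))
      (ddSfun (t ^+ 2 * x) * (2 * t * x)).
    exact: (@is_derive1_comp R dSfun (fun s => s ^+ 2 * x) t _ _ d1 d2).
  apply: is_derive_eq; rewrite /GRing.scale /=.
  have := mulr_ddSfun (t ^+ 2 * x) => e.
  have -> : t ^+ 3 * (ddSfun (t ^+ 2 * x) * (2 * t * x)) =
    t ^+ 2 * (2 * (t ^+ 2 * x) * ddSfun (t ^+ 2 * x)) by ring.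
  by rewrite e; field.
(* As h(0) = 0 and h(1) = S'(x), the latter equals h'(c) for some c in (0, 1), which is positive
   since c^2 x > - pi^2. *)
have [c /andP[c0 c1]] := MVT_derive ltr01 (fun t _ => dh t).
rewrite /h subr0 mulr1 !expr1n expr0n /= !mul1r mul0r subr0 => ->.
rewrite divr_gt0// mulr_gt0 ?exprn_gt0// Sfun_gt0//.
have c2 : 0 < c ^+ 2 < 1 by rewrite exprn_gt0//= expr_lt1// ltW.
by have [x0|x0] := leP 0 x; nra.
Qed.

Lemma sin_ler (t : R) : 0 <= t -> sin t <= t.
Proof.
rewrite le_eqVlt => /predU1P[<-|t0]; first by rewrite sin0.
have [c _] := MVT_derive t0 (fun s _ => is_derive_sin s).
by rewrite sin0 !subr0 => ->; rewrite ler_piMl ?cos_le1// ltW.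
Qed.

(* Multiplied by [x], the right-hand side becomes [S (4 x) - 1]. *)
Lemma Sfun_turan x : - pi ^+ 2 < x -> 0 <= Sfun x ^+ 2 - 2 * Cfun x * dSfun x.
Proof.
move=> hx; set T := _ - _.
have pi2 : (0 : R) < pi ^+ 2 by rewrite exprn_gt0// pi_gt0.
have xT : x * T = Sfun (4 * x) - 1.
  have e1 := CfunSfun_unit x; have e2 := mulr_dSfun x.
  rewrite Sfun_double /T mulrBr.
  have -> : x * (2 * Cfun x * dSfun x) = Cfun x * (2 * x * dSfun x) by ring.
  by rewrite e2 -e1; ring.
(* For x < 0 the bound S(4x) <= 1 is sin r <= r; for x > 0, S increases from S(0) = 1. *)
case: (ltgtP x 0) => [x0|x0|x0].
- rewrite -(nmulr_rle0 _ x0) xT subr_le0 /Sfun.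
  have x4 : 4 * x < 0 by rewrite pmulr_rlt0.
  rewrite (lt_gtF x4) (lt_eqF x4); set r := Num.sqrt _.
  have r0 : 0 < r by rewrite sqrtr_gt0 oppr_gt0.
  by rewrite ler_pdivrMr// mul1r sin_ler// ltW.
- rewrite -(pmulr_rge0 _ x0) xT subr_ge0.
  have x4 : 0 < 4 * x by rewrite mulr_gt0.
  have [c /andP[c0 _]] := MVT_derive x4 (fun s _ => is_derive_Sfun s).
  rewrite Sfun0 subr0 => e; rewrite -subr_ge0 e mulr_ge0 ?ltW// dSfun_gt0//.
  by lra.
(* At 0 nothing can be divided by x; the second-order relation gives S'(0) = 1/6, hence T = 2/3. *)
- have := mulr_ddSfun 0; rewrite mulr0 mul0r Sfun0 /T x0 Cfun0 Sfun0.
  by lra.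
Qed.

(* [t * S' (t x) / S (t x)] has derivative [(S ^ 2 - 2 C S') / (4 S ^ 2)],
   evaluated at [t x]. *)
Lemma dSfun_div_Sfun_scale x (t : R) : - pi ^+ 2 < x -> 0 <= t <= 1 ->
  t * dSfun (t * x) * Sfun x <= dSfun x * Sfun (t * x).
Proof.
move=> hx /andP[t0 t1].
have pi2 : (0 : R) < pi ^+ 2 by rewrite exprn_gt0// pi_gt0.
have scale_gt (s : R) : 0 <= s <= 1 -> - pi ^+ 2 < s * x.
  by move=> /andP[s0 s1]; have [x0|x0] := leP 0 x; nra.
move: t1; rewrite le_eqVlt => /predU1P[->|t1]; first by rewrite !mul1r.
pose g (s : R) := s * dSfun (s * x) / Sfun (s * x).
pose dg (s : R) := (Sfun (s * x) ^+ 2 - 2 * Cfun (s * x) * dSfun (s * x))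
  / (4 * Sfun (s * x) ^+ 2).
have gD (s : R) : t <= s <= 1 -> is_derive s 1 g (dg s).
  move=> /andP[ts s1].
  have Sp : 0 < Sfun (s * x) by apply/Sfun_gt0/scale_gt; rewrite s1 (le_trans t0).
  have d0 : is_derive s 1 (fun s => s * x) x.
    by apply: is_derive_eq; rewrite /GRing.scale /=; ring.
  have d1 : is_derive s 1 (fun s => dSfun (s * x)) (ddSfun (s * x) * x).
    exact: (@is_derive1_comp R dSfun (fun r => r * x) s _ _ (is_derive_dSfun _) d0).
  have d2 : is_derive s 1 (fun s => Sfun (s * x)) (dSfun (s * x) * x).
    exact: (@is_derive1_comp R Sfun (fun r => r * x) s _ _ (is_derive_Sfun _) d0).
  have Sn : Sfun (s * x) != 0 by rewrite gt_eqF.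
  have d3 := @is_deriveV R (fun r => Sfun (r * x)) s _ 1 Sn d2.
  apply: is_derive_eq; rewrite /GRing.scale /= /dg.
  have := mulr_ddSfun (s * x); have := mulr_dSfun (s * x).
  move: (Sfun (s * x)) Sn (dSfun (s * x)) (ddSfun (s * x)) (Cfun (s * x)).
  move=> S S0 D E C e2 e1.
  (* Arranged so that 2 y S' and 2 y S'' occur, with y = s x; the two differential relations then
     eliminate y and S''. *)
  transitivity ((2 * D + 2 * (s * x) * E) / (2 * S)
    - D * (2 * (s * x) * D) / (2 * S ^+ 2)); first by field.
  by rewrite e1 e2; field.
have [c /andP[tc c1]] := MVT_derive t1 gD.
rewrite /g !mul1r => e.
have c01 : 0 <= c <= 1 by rewrite (le_trans t0) ltW.
have dg0 : 0 <= dg c.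
  rewrite /dg divr_ge0 ?Sfun_turan ?scale_gt//.
  by rewrite mulr_ge0// sqr_ge0.
have Sx : 0 < Sfun x := Sfun_gt0 hx.
have St : 0 < Sfun (t * x) by apply/Sfun_gt0/scale_gt; rewrite t0 ltW.
have : t * dSfun (t * x) / Sfun (t * x) <= dSfun x / Sfun x.
  by rewrite -subr_ge0 e mulr_ge0// subr_ge0 ltW.
by rewrite ler_pdivrMr// mulrAC ler_pdivlMr.
Qed.

End CSFunctions.

(** * The exponential of a complex 2 x 2 matrix *)

Local Open Scope complex_scope.

(** * Entries, trace and determinant of 2 x 2 matrices *)

Section Matrix2.
Variable K : comNzRingType.
Implicit Types A B : 'M[K]_2.

Lemma ord2P (P : 'I_2 -> Prop) : P 0 -> P 1 -> forall i, P i.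
Proof.
move=> p0 p1 [[|[|//]] hi].
  by rewrite (_ : Ordinal hi = 0)//; exact: val_inj.
by rewrite (_ : Ordinal hi = 1)//; exact: val_inj.
Qed.

Lemma matrix2P A B :
  A 0 0 = B 0 0 -> A 0 1 = B 0 1 -> A 1 0 = B 1 0 -> A 1 1 = B 1 1 -> A = B.
Proof.
by move=> h00 h01 h10 h11; apply/matrixP; apply: ord2P; apply: ord2P.
Qed.

Lemma mulmx2E A B i j : (A *m B) i j = A i 0 * B 0 j + A i 1 * B 1 j.
Proof.
rewrite mxE !big_ord_recl big_ord0 addr0.
by rewrite (_ : lift ord0 ord0 = 1)//; exact: val_inj.
Qed.

Lemma mxtrace2E A : \tr A = A 0 0 + A 1 1.
Proof.
rewrite /mxtrace !big_ord_recl big_ord0 addr0.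
by rewrite (_ : lift ord0 ord0 = 1)//; exact: val_inj.
Qed.

Lemma det2E A : \det A = A 0 0 * A 1 1 - A 0 1 * A 1 0.
Proof.
rewrite (expand_det_row _ 0) !big_ord_recl big_ord0 addr0 /cofactor !det_mx11.
rewrite !mxE /= (_ : lift ord0 ord0 = 1); last exact: val_inj.
rewrite (_ : lift 1 0 = 0); last exact: val_inj.
by rewrite expr0 mul1r expr1 mulN1r mulrN.
Qed.

(** Cayley-Hamilton for a traceless matrix. *)
Lemma mulmx_sl2 A : \tr A = 0 -> A *m A = (- \det A)%:M.
Proof.
rewrite mxtrace2E det2E => /eqP; rewrite addr_eq0 => /eqP A00.
by apply: matrix2P; rewrite !mulmx2E !mxE /= A00; ring.
Qed.

End Matrix2.

(** The partial sums stay in the span of 1 and A, so two scalar limits suffice. *)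
Lemma expmx_lim (K : numFieldType) (A : 'M[K]_2) (u v : nat -> K) (a b : K) :
  (forall n, series (fun k => k`!%:R^-1 *: A ^+ k) n = u n *: 1%:M + v n *: A) ->
  u @ \oo --> a -> v @ \oo --> b -> expmx A = a *: 1%:M + b *: A.
Proof.
move=> uvE ua vb; rewrite /expmx; apply/cvg_lim => //.
rewrite (funext uvE).
by apply: cvgD; exact: cvgZr_tmp.
Qed.

(** * Summing the exponential series of a matrix with real scalar square *)

Section ExpMatrix.
Variable R : realType.

Lemma cvg_real_complex (u : R^nat) (l : R) :
  u @ \oo --> l ->
  (fun n => (u n)%:C : (R[i] : numFieldType)) @ \oo --> (l%:C : (R[i] : numFieldType)).
Proof.
move=> ul; apply/cvgrPdist_lt => -[e1 e2].
(* A positive element of [R[i]] is real. *)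
rewrite ltcE /= => /andP[/eqP -> e10].
move/cvgrPdist_lt: ul => /(_ _ e10); apply: filterS => n.
by rewrite -rmorphB normc_def /= expr0n addr0 sqrtr_sqr ltcR.
Qed.

Lemma cvg_half : half n @[n --> \oo] --> \oo.
Proof.
apply/cvgnyPge => A; near=> n; rewrite -(doubleK A) half_leq//.
by near: n; exact: nbhs_infty_ge.
Unshelve. all: by end_near. Qed.

Lemma cvg_uphalf : uphalf n @[n --> \oo] --> \oo.
Proof.
apply/cvgnyPge => A; near=> n.
rewrite -(doubleK A) (leq_trans (half_leq _) (half_leq (leqnSn n)))//.
by near: n; exact: nbhs_infty_ge.
Unshelve. all: by end_near. Qed.

(** A^(2k) = q^k and A^(2k+1) = q^k A; of the first n terms, [uphalf n] have an even exponent and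
    [n./2] an odd one. *)
Lemma exp_series_sqr (A : 'M[R[i]]_2) (q : R) n : A *m A = q%:C%:M ->
  series (fun n => n`!%:R^-1 *: A ^+ n) n =
  (pseries (Ccoef R) q (uphalf n))%:C *: 1%:M + (pseries (Scoef R) q n./2)%:C *: A.
Proof.
move=> AA; have A2 : A ^+ 2 = q%:C%:M by rewrite expr2.
have Ad k : A ^+ k.*2 = (q ^+ k)%:C *: 1%:M.
  rewrite -mul2n exprM A2 scalemx1 rmorphXn.
  by elim: k => [|k ih]; rewrite ?expr0// !exprS ih -[_ * _]scalar_mxM.
have invC k : (k`!%:R : R[i])^-1 = (k`!%:R^-1 : R)%:C.
  by rewrite fmorphV rmorph_nat.
have even k : series (fun n => n`!%:R^-1 *: A ^+ n) k.*2.+1 =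
    series (fun n => n`!%:R^-1 *: A ^+ n) k.*2
    + (Ccoef R k * q ^+ k)%:C *: 1%:M.
  by rewrite seriesSr invC Ad scalerA -rmorphM.
have odd k : series (fun n => n`!%:R^-1 *: A ^+ n) k.*2.+2 =
    series (fun n => n`!%:R^-1 *: A ^+ n) k.*2.+1
    + (Scoef R k * q ^+ k)%:C *: A.
  rewrite seriesSr invC exprSr Ad -scalerAl scalerA -rmorphM.
  by rewrite -[_ * A]/(1%:M *m A) mul1mx.
have main k : series (fun n => n`!%:R^-1 *: A ^+ n) k.*2 =
    (pseries (Ccoef R) q k)%:C *: 1%:M + (pseries (Scoef R) q k)%:C *: A.
  elim: k => [|k ih]; first by rewrite /pseries /series /= !big_geq// !scale0r addr0.
  rewrite doubleS odd even ih /pseries !seriesSr !rmorphD !scalerDl /=.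
  by rewrite addrACA addrA.
rewrite -{1}(odd_double_half n) uphalf_half; case: (ssrnat.odd n).
  rewrite add1n even main /pseries add1n seriesSr rmorphD scalerDl /=.
  by rewrite addrAC.
by rewrite !add0n main.
Qed.

Lemma expmx_sqr (A : 'M[R[i]]_2) (q : R) : A *m A = q%:C%:M ->
  expmx A = (Cfun q)%:C%:M + (Sfun q)%:C *: A.
Proof.
move=> AA; rewrite -scalemx1.
apply: (@expmx_lim (R[i] : numFieldType) A
  (fun n => (pseries (Ccoef R) q (uphalf n))%:C)
  (fun n => (pseries (Scoef R) q n./2)%:C)).
- by move=> n; exact: exp_series_sqr.
- apply: (@cvg_real_complex (fun n => pseries (Ccoef R) q (uphalf n))).
  rewrite CfunE; apply: cvg_comp cvg_uphalf _.
  exact: is_cvg_pseries_fact (fact_bounded_Ccoef R).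
- apply: (@cvg_real_complex (fun n => pseries (Scoef R) q n./2)).
  rewrite SfunE; apply: cvg_comp cvg_half _.
  exact: is_cvg_pseries_fact (fact_bounded_Scoef R).
Qed.

(** (iY)^2 = - Y^2 = det Y. *)
Lemma expmx_i (Y : 'M[R]_2) : \tr Y = 0 ->
  expmx ('i *: complexify Y) =
  (Cfun (\det Y))%:C%:M + (Sfun (\det Y))%:C *: ('i *: complexify Y).
Proof.
move=> /mulmx_sl2 YY; apply: expmx_sqr.
rewrite -scalemxAl -scalemxAr scalerA -expr2 sqr_i -map_mxM YY map_scalar_mx.
by rewrite rmorphN scaleN1r -raddfN opprK.
Qed.

End ExpMatrix.

(** * The differential of P_m *)

Section RealDiff.
Variables (R : realType) (V : normedModType R).
Implicit Types (f g df dg : V -> R) (p : V).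

Lemma is_diff_ext (W : normedModType R) p (f f' df df' : V -> W) :
  f =1 f' -> df =1 df' -> is_diff p f df -> is_diff p f' df'.
Proof. by move=> /funext -> /funext ->. Qed.

Lemma is_diff_linear f p : linear f -> continuous f -> is_diff p f f.
Proof.
move=> flin fcont.
pose fM := GRing.isLinear.Build _ _ _ _ f flin.
pose fL : {linear V -> R} := HB.pack f fM.
apply: DiffDef; first exact: (@linear_differentiable _ _ _ fL).
by rewrite (@diff_lin _ _ _ fL).
Qed.

Lemma is_diff_mul p f g df dg : is_diff p f df -> is_diff p g dg ->
  is_diff p (fun q => f q * g q) (fun v => df v * g p + f p * dg v).
Proof.
move=> hf hg; apply: is_diff_ext (is_diffM hf hg) => // v.
by rewrite /= !fctE /GRing.scale /=; ring.
Qed.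

Lemma is_diff_add p f g df dg : is_diff p f df -> is_diff p g dg ->
  is_diff p (fun q => f q + g q) (fun v => df v + dg v).
Proof. by move=> hf hg; exact: is_diffD. Qed.

Lemma is_diff_sub p f g df dg : is_diff p f df -> is_diff p g dg ->
  is_diff p (fun q => f q - g q) (fun v => df v - dg v).
Proof. by move=> hf hg; exact: is_diffB. Qed.

Lemma is_diff_const p (c : R) : is_diff p (fun _ : V => c) (fun _ => 0).
Proof. exact: is_diff_cst. Qed.

Lemma is_diff_comp1 p f df (h : R -> R) (h' : R) : is_diff p f df ->
  is_derive (f p) (1 : R) h h' -> is_diff p (fun q => h (f q)) (fun v => h' * df v).
Proof.
move=> hf hh.
have hd : is_diff (f p) h ( *:%R ^~ h').
  have dh : derivable h (f p) 1 by [].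
  apply: DiffDef; first exact/derivable1_diffP.
  by rewrite deriv1E// derive1E derive_val.
by apply: is_diff_ext (is_diff_comp hf hd) => // v; rewrite /= mulrC.
Qed.

Lemma is_diff_mx2 p (F dF : V -> 'M[R]_2) :
  (forall i j, is_diff p (fun q => F q i j) (fun v => dF v i j)) ->
  is_diff p F dF.
Proof.
move=> h.
have hZ i j : is_diff p (fun q => F q i j *: (delta_mx i j : 'M[R]_2))
                       (fun v => dF v i j *: (delta_mx i j : 'M[R]_2)).
  have hij := h i j.
  apply: DiffDef; first exact: differentiableZl.
  by rewrite diffZl// diff_val.
have decomp (A : 'M[R]_2) : A = A 0 0 *: delta_mx 0 0 + A 0 1 *: delta_mx 0 1
    + A 1 0 *: delta_mx 1 0 + A 1 1 *: delta_mx 1 1.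
  by apply: matrix2P; rewrite !mxE /=; ring.
have hD := is_diffD (is_diffD (is_diffD (hZ 0 0) (hZ 0 1)) (hZ 1 0)) (hZ 1 1).
by apply: is_diff_ext hD => q; rewrite [RHS]decomp.
Qed.

(** Real differentiability of a complex-valued map, split into two real parts to match [realify]. *)
Definition is_cdiff p (f df : V -> R[i]) :=
  is_diff p (fun q => complex.Re (f q)) (fun v => complex.Re (df v)) /\
  is_diff p (fun q => complex.Im (f q)) (fun v => complex.Im (df v)).

Definition is_mdiff p (f df : V -> 'M[R[i]]_2) :=
  forall i j, is_cdiff p (fun q => f q i j) (fun v => df v i j).

Lemma is_cdiff_ext p (F F' dF dF' : V -> R[i]) : F =1 F' -> dF =1 dF' ->
  is_cdiff p F dF -> is_cdiff p F' dF'.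
Proof. by move=> /funext -> /funext ->. Qed.

Lemma is_cdiff_add p F G dF dG : is_cdiff p F dF -> is_cdiff p G dG ->
  is_cdiff p (fun q => F q + G q) (fun v => dF v + dG v).
Proof.
move=> [f1 f2] [g1 g2]; split.
  by apply: is_diff_ext (is_diff_add f1 g1) => q; rewrite raddfD.
by apply: is_diff_ext (is_diff_add f2 g2) => q; rewrite raddfD.
Qed.

Lemma is_cdiff_mul p F G dF dG : is_cdiff p F dF -> is_cdiff p G dG ->
  is_cdiff p (fun q => F q * G q) (fun v => dF v * G p + F p * dG v).
Proof.
move=> [f1 f2] [g1 g2]; split.
  apply: is_diff_ext (is_diff_sub (is_diff_mul f1 g1) (is_diff_mul f2 g2)) => q.
    by case: (F q) (G q) => a b [c d].
  by case: (F p) (G p) (dF q) (dG q) => a b [c d] [a' b'] [c' d'] /=; ring.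
apply: is_diff_ext (is_diff_add (is_diff_mul f1 g2) (is_diff_mul f2 g1)) => q.
  by case: (F q) (G q) => a b [c d] /=; ring.
by case: (F p) (G p) (dF q) (dG q) => a b [c d] [a' b'] [c' d'] /=; ring.
Qed.

Lemma is_mdiff_mul p F G dF dG : is_mdiff p F dF -> is_mdiff p G dG ->
  is_mdiff p (fun q => F q *m G q) (fun v => dF v *m G p + F p *m dG v).
Proof.
move=> hF hG i j; apply: is_cdiff_ext (is_cdiff_add
  (is_cdiff_mul (hF i 0) (hG 0 j)) (is_cdiff_mul (hF i 1) (hG 1 j))) => q.
  by rewrite mulmx2E.
by rewrite mxE !mulmx2E; ring.
Qed.

Lemma is_diff_realify p F dF : is_mdiff p F dF ->
  is_diff p (realify \o F) (realify \o dF).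
Proof.
move=> h; apply: is_diff_pair; apply: is_diff_mx2 => i j.
  by apply: is_diff_ext (h i j).1 => q; rewrite mxE.
by apply: is_diff_ext (h i j).2 => q; rewrite mxE.
Qed.

Lemma is_cdiff_complex p f df : is_diff p f df ->
  is_cdiff p (fun q => (f q)%:C) (fun v => (df v)%:C).
Proof. by move=> h; split=> //=; exact: is_diff_const. Qed.

(** Inverse of [realify]; it keeps real and imaginary parts visible through matrix products. *)
Definition mkmx (A B : 'M[R]_2) : 'M[R[i]]_2 :=
  complexify A + 'i *: complexify B.

Lemma is_mdiff_mkmx p (A B dA dB : V -> 'M[R]_2) :
  (forall i j, is_diff p (fun q => A q i j) (fun v => dA v i j)) ->
  (forall i j, is_diff p (fun q => B q i j) (fun v => dB v i j)) ->
  is_mdiff p (fun q => mkmx (A q) (B q)) (fun v => mkmx (dA v) (dB v)).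
Proof.
move=> hA hB i j; split.
  by apply: is_diff_ext (hA i j) => q; rewrite !mxE /=; ring.
by apply: is_diff_ext (hB i j) => q; rewrite !mxE /=; ring.
Qed.

(* The exponential of ['i Y] for [Y] real and traceless. *)
Definition expi (Y : 'M[R]_2) : 'M[R[i]]_2 :=
  mkmx (Cfun (\det Y))%:M (Sfun (\det Y) *: Y).

Definition ddet (Y dY : 'M[R]_2) : R :=
  dY 0 0 * Y 1 1 + Y 0 0 * dY 1 1 - (dY 0 1 * Y 1 0 + Y 0 1 * dY 1 0).

(** Derivative of [expi] at Y along dY, from C' = S/2 and the product rule; [ddet] is that of the
    determinant. *)
Definition dexpi (Y dY : 'M[R]_2) : 'M[R[i]]_2 :=
  mkmx (Sfun (\det Y) / 2 * ddet Y dY)%:M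
    ((dSfun (\det Y) * ddet Y dY) *: Y + Sfun (\det Y) *: dY).

Lemma is_mdiff_expi p (Y dY : V -> 'M[R]_2) :
  (forall i j, is_diff p (fun q => Y q i j) (fun v => dY v i j)) ->
  is_mdiff p (fun q => expi (Y q)) (fun v => dexpi (Y p) (dY v)).
Proof.
move=> hY.
have hdet : is_diff p (fun q => \det (Y q)) (fun v => ddet (Y p) (dY v)).
  apply: is_diff_ext (is_diff_sub (is_diff_mul (hY 0 0) (hY 1 1))
    (is_diff_mul (hY 0 1) (hY 1 0))) => q //; by rewrite det2E.
have hC := is_diff_comp1 hdet (is_derive_Cfun (\det (Y p))).
have hS := is_diff_comp1 hdet (is_derive_Sfun (\det (Y p))).
apply: is_mdiff_mkmx => i j.
  have [ij|ij] := eqVneq i j.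
    by apply: is_diff_ext hC => q; rewrite mxE ij eqxx mulr1n.
  by apply: is_diff_ext (is_diff_const p 0) => q; rewrite mxE (negPf ij) mulr0n.
by apply: is_diff_ext (is_diff_mul hS (hY i j)) => q; rewrite !mxE.
Qed.

End RealDiff.

(** * The differential of P_m by the product rule *)

Section Pmap.
Variables (R : realType) (m : R).
Let V := ('M[R]_2 * 'M[R]_2)%type.
Implicit Types p v : V.

Lemma is_diff_fst p i j : is_diff p (fun q : V => q.1 i j) (fun v => v.1 i j).
Proof.
apply: is_diff_linear; first by move=> a u v; rewrite /= !mxE.
move=> q; apply: (@continuous_comp _ _ _ fst (fun A : 'M[R]_2 => A i j)).
  exact: cvg_fst.
exact: coord_continuous.
Qed.

Lemma is_diff_snd p i j : is_diff p (fun q : V => q.2 i j) (fun v => v.2 i j).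
Proof.
apply: is_diff_linear; first by move=> a u v; rewrite /= !mxE.
move=> q; apply: (@continuous_comp _ _ _ snd (fun A : 'M[R]_2 => A i j)).
  exact: cvg_snd.
exact: coord_continuous.
Qed.

(** The exponents of P_m without the factor i. Both are linear in X, hence their own differentials,
    and traceless for every X. *)
Definition Yfst (X : 'M[R]_2) := - m *: kproj X + pproj X.
Definition Ysnd (X : 'M[R]_2) := (1 + m) *: kproj X.

Lemma is_diff_mul_const p (f df : V -> R) (c : R) : is_diff p f df ->
  is_diff p (fun q => f q * c) (fun v => df v * c).
Proof.
move=> h; apply: is_diff_ext (is_diff_mul h (is_diff_const p c)) => // v /=.
by rewrite mulr0 addr0.
Qed.

Lemma is_diff_kproj p i j :
  is_diff p (fun q : V => kproj q.2 i j) (fun v => kproj v.2 i j).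
Proof.
have h := is_diff_mul_const (mxU i j)
  (is_diff_mul_const 2^-1 (is_diff_sub (is_diff_snd p 1 0) (is_diff_snd p 0 1))).
by apply: is_diff_ext h => q; rewrite [RHS]mxE.
Qed.

Lemma is_diff_pproj p i j :
  is_diff p (fun q : V => pproj q.2 i j) (fun v => pproj v.2 i j).
Proof.
have h1 := is_diff_mul_const (mxH i j)
  (is_diff_mul_const 2^-1 (is_diff_sub (is_diff_snd p 0 0) (is_diff_snd p 1 1))).
have h2 := is_diff_mul_const (mxW i j)
  (is_diff_mul_const 2^-1 (is_diff_add (is_diff_snd p 0 1) (is_diff_snd p 1 0))).
apply: is_diff_ext (is_diff_add h1 h2) => q;
  by rewrite [RHS]mxE; congr (_ + _); rewrite [RHS]mxE.
Qed.

Lemma is_diff_Yfst p i j :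
  is_diff p (fun q : V => Yfst q.2 i j) (fun v => Yfst v.2 i j).
Proof.
have h := is_diff_add (is_diff_mul_const (- m) (is_diff_kproj p i j))
  (is_diff_pproj p i j).
by apply: is_diff_ext h => q; rewrite [RHS]mxE mulrC; congr (_ + _); rewrite [RHS]mxE.
Qed.

Lemma is_diff_Ysnd p i j :
  is_diff p (fun q : V => Ysnd q.2 i j) (fun v => Ysnd v.2 i j).
Proof.
have h := is_diff_mul_const (1 + m) (is_diff_kproj p i j).
by apply: is_diff_ext h => q; rewrite [RHS]mxE mulrC.
Qed.

Lemma mxtrace_mxU : \tr (mxU : 'M[R]_2) = 0.
Proof. by rewrite mxtrace2E !mxE /=; ring. Qed.

Lemma mxtrace_mxH : \tr (mxH : 'M[R]_2) = 0.
Proof. by rewrite mxtrace2E !mxE /=; ring. Qed.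

Lemma mxtrace_mxW : \tr (mxW : 'M[R]_2) = 0.
Proof. by rewrite mxtrace2E !mxE /=; ring. Qed.

Lemma mxtrace_Yfst X : \tr (Yfst X) = 0.
Proof.
by rewrite /Yfst /kproj /pproj !mxtraceD !mxtraceZ mxtrace_mxU mxtrace_mxH mxtrace_mxW; ring.
Qed.

Lemma mxtrace_Ysnd X : \tr (Ysnd X) = 0.
Proof. by rewrite /Ysnd /kproj !mxtraceZ mxtrace_mxU; ring. Qed.

Lemma expmx_expi (Y : 'M[R]_2) : \tr Y = 0 -> expmx ('i *: complexify Y) = expi Y.
Proof.
move=> /expmx_i ->; rewrite /expi /mkmx /complexify map_scalar_mx map_mxZ.
by rewrite !scalerA mulrC.
Qed.

Lemma PmapE p : Pmap m p = complexify p.1 *m expi (Yfst p.2) *m expi (Ysnd p.2).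
Proof. by rewrite /Pmap !expmx_expi ?mxtrace_Yfst ?mxtrace_Ysnd. Qed.

(** Leibniz rule over the three factors of P_m, at p along v. *)
Definition dPmap p v : 'M[R[i]]_2 :=
  (complexify v.1 *m expi (Yfst p.2)
   + complexify p.1 *m dexpi (Yfst p.2) (Yfst v.2)) *m expi (Ysnd p.2)
  + complexify p.1 *m expi (Yfst p.2) *m dexpi (Ysnd p.2) (Ysnd v.2).

Lemma diff_Pmap p : 'd (realify \o Pmap m) p = realify \o dPmap p :> (V -> V).
Proof.
have hX : is_mdiff p (fun q : V => complexify q.1) (fun v => complexify v.1).
  move=> i j; apply: is_cdiff_ext (is_cdiff_complex (is_diff_fst p i j)) => q;
  by rewrite mxE.
have h := is_mdiff_mul (is_mdiff_mul hX (is_mdiff_expi (is_diff_Yfst p)))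
  (is_mdiff_expi (is_diff_Ysnd p)).
have -> : realify \o Pmap m = realify \o
  (fun q => complexify q.1 *m expi (Yfst q.2) *m expi (Ysnd q.2)).
  by apply/funext => q; rewrite /= PmapE.
have hd := is_diff_realify h.
by rewrite (@diff_val _ _ _ _ _ _ _ hd).
Qed.

End Pmap.

(** * Non-singular points of the slice *)

(** D and D' F stand for the derivatives of E and F, so D' is a logarithmic derivative; the
    derivative of g E F at g = 1 thereby acquires its value as a right factor. *)
Lemma mulmx_dproduct (K : comNzRingType) (Z E E' D D' F : 'M[K]_2) :
  E' *m E = 1%:M ->
  (Z *m E + 1%:M *m D) *m F + 1%:M *m E *m (D' *m F) =
  (Z + (D *m E' + E *m D' *m E')) *m (1%:M *m E *m F).
Proof.
move=> EE; rewrite !mul1mx !mulmxDl -!mulmxA.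
by rewrite (mulmxA E' E F) EE mul1mx addrA.
Qed.

Lemma mulmx_inv2 (K : comNzRingType) (A A' B B' : 'M[K]_2) :
  A *m A' = 1%:M -> B *m B' = 1%:M -> (A *m B) *m (B' *m A') = 1%:M.
Proof. by move=> AA BB; rewrite -mulmxA (mulmxA B) BB mul1mx. Qed.

Lemma mulmx_rcancel (K : comNzRingType) (A A' M N : 'M[K]_2) :
  A *m A' = 1%:M -> M *m A = N *m A -> M = N.
Proof. by move=> AA e; rewrite -(mulmx1 M) -(mulmx1 N) -AA !mulmxA e. Qed.

(** sl_2 is stable under conjugation, so the left translate A sl_2 is also the right translate sl_2
    A. *)
Lemma tangentSL2_mulmx (K : comNzRingType) (A A' N : 'M[K]_2) :
  A *m A' = 1%:M -> A' *m A = 1%:M -> tangentSL2 A (N *m A) <-> \tr N = 0.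
Proof.
move=> AA' A'A; split=> [[V trV AV]|trN].
  have -> : N = A *m V *m A' by rewrite AV -mulmxA AA' mulmx1.
  by rewrite -mulmxA mxtrace_mulC -mulmxA A'A mulmx1.
exists (A' *m N *m A); last by rewrite !mulmxA AA' mul1mx.
by rewrite /sl2 /= -mulmxA mxtrace_mulC -mulmxA AA' mulmx1.
Qed.

(** * Products of matrices A + iB and exponentials of traceless exponents *)

Section MkMx.
Variable R : realType.
Implicit Types A B X Y Z : 'M[R]_2.

Lemma mulmx_mkmx A B A' B' :
  mkmx A B *m mkmx A' B' = mkmx (A *m A' - B *m B') (A *m B' + B *m A').
Proof.
rewrite /mkmx /complexify mulmxDl !mulmxDr map_mxB map_mxD !map_mxM.
rewrite -!scalemxAl -!scalemxAr scalerA -expr2 sqr_i scaleN1r scalerDr.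
by rewrite [X in _ + X]addrC addrACA.
Qed.

Lemma add_mkmx A B A' B' : mkmx A B + mkmx A' B' = mkmx (A + A') (B + B').
Proof. by rewrite /mkmx /complexify !map_mxD scalerDr addrACA. Qed.

Lemma realify_mkmx A B : realify (mkmx A B) = (A, B).
Proof.
by congr (_, _); apply/matrixP => i j; rewrite !mxE /=; ring.
Qed.

Lemma mkmx_realify (M : 'M[R[i]]_2) : mkmx (realify M).1 (realify M).2 = M.
Proof.
apply/matrixP => i j; rewrite !mxE /=; case: (M i j) => x y /=.
by simpc.
Qed.

Lemma realify_inj : injective (@realify R).
Proof. by move=> M N e; rewrite -(mkmx_realify M) e mkmx_realify. Qed.

Lemma mxtrace_mkmx A B : (\tr (mkmx A B) = 0) <-> (\tr A = 0 /\ \tr B = 0).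
Proof.
rewrite !mxtrace2E !mxE; split=> [|[h1 h2]].
  move=> /eqP; rewrite eq_complex /= => /andP[/eqP h1 /eqP h2].
  by split; [rewrite -[RHS]h1|rewrite -[RHS]h2]; ring.
apply/eqP; rewrite eq_complex /=; apply/andP; split; apply/eqP.
  by rewrite -[RHS]h1; ring.
by rewrite -[RHS]h2; ring.
Qed.

Lemma complexify_mkmx Z : complexify Z = mkmx Z 0.
Proof. by rewrite /mkmx /complexify [in RHS]map_mx0 scaler0 addr0. Qed.

Lemma mxtraceN2 Z : \tr (- Z) = - \tr Z.
Proof. exact: raddfN. Qed.

Lemma complexify1 : complexify 1%:M = 1%:M :> 'M[R[i]]_2.
Proof. exact: map_mx1. Qed.

Lemma mkmx1 : mkmx 1%:M 0 = 1%:M :> 'M[R[i]]_2.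
Proof. by rewrite -complexify_mkmx complexify1. Qed.

Lemma det2N Y : \det (- Y) = \det Y.
Proof. by rewrite !det2E !mxE; ring. Qed.

(** (C + iSY)(C - iSY) = C^2 + S^2 Y^2 = C^2 - det(Y) S^2 = 1. *)
Lemma expiN Y : \tr Y = 0 -> expi Y *m expi (- Y) = 1%:M.
Proof.
move=> /mulmx_sl2 YY; rewrite /expi det2N mulmx_mkmx -mkmx1.
have e := CfunSfun_unit (\det Y).
have {}e : Cfun (\det Y) ^+ 2 = 1 + \det Y * Sfun (\det Y) ^+ 2 by rewrite -e; ring.
congr mkmx.
  rewrite -scalar_mxM scalerN mulmxN -scalemxAl -scalemxAr YY.
  by apply: matrix2P; rewrite !mxE /=; ring: e.
by rewrite mul_scalar_mx mul_mx_scalar !scalerN addNr.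
Qed.

Lemma expiNl Y : \tr Y = 0 -> expi (- Y) *m expi Y = 1%:M.
Proof. by move=> trY; exact/mulmx1C/expiN. Qed.

(** A variation parallel to the exponent commutes with it. This serves the last factor of P_m, whose
    exponents all lie in R U. *)
Lemma dexpi_scale Y (s r : R) : \tr Y = 0 ->
  dexpi (s *: Y) (r *: Y) = mkmx 0 (r *: Y) *m expi (s *: Y).
Proof.
rewrite mxtrace2E => /eqP; rewrite addr_eq0 => /eqP trY.
rewrite /dexpi /expi mulmx_mkmx.
have e := mulr_dSfun (\det (s *: Y)).
have ed : ddet (s *: Y) (r *: Y) = 2 * s * r * \det Y.
  by rewrite /ddet det2E !mxE; ring.
have es : \det (s *: Y) = s ^+ 2 * \det Y by rewrite !det2E !mxE; ring.
rewrite mul0mx sub0r mul0mx add0r ed.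
have YY : Y *m Y = (- \det Y)%:M by apply: mulmx_sl2; rewrite mxtrace2E trY addNr.
congr mkmx.
  rewrite -!scalemxAl -!scalemxAr YY.
  by apply: matrix2P; rewrite !mxE /=; field.
rewrite mul_mx_scalar !scalerA -scalerDl; congr (_ *: _).
have -> : Cfun (\det (s *: Y)) = Sfun (\det (s *: Y))
  + 2 * (s ^+ 2 * \det Y) * dSfun (\det (s *: Y)) by rewrite -es e; ring.
by ring.
Qed.

(** Derivative of S(4x) = C(x) S(x), multiplied by 2. *)
Lemma dSfun_double (x : R) :
  8 * dSfun (4 * x) = Sfun x ^+ 2 + 2 * Cfun x * dSfun x.
Proof.
have hS := is_derive_Sfun x; have hC := is_derive_Cfun x.
have d4 : is_derive x (1 : R) (fun y : R => 4 * y) 4.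
  by apply: is_derive_eq; rewrite /GRing.scale /=; ring.
have d1 := @is_derive1_comp R Sfun (fun y => 4 * y) x _ _
  (is_derive_Sfun (4 * x)) d4.
have d2 := is_deriveM hC hS.
have E : Sfun \o (fun y : R => 4 * y) = Cfun * Sfun.
  by apply/funext => y; exact: Sfun_double.
rewrite E in d1; have := derive_val (is_derive := d1).
by rewrite (derive_val (is_derive := d2)) /GRing.scale /= => e; lra.
Qed.

(** * The derivative of P_m in the basis U, H, W *)

Definition cU X : R := (X 1 0 - X 0 1) / 2.
Definition cH X : R := (X 0 0 - X 1 1) / 2.
Definition cW X : R := (X 0 1 + X 1 0) / 2.
Definition uhw (u h w : R) : 'M[R]_2 := u *: mxU + h *: mxH + w *: mxW.

Lemma uhwE u h w :
  (uhw u h w 0 0 = h) * (uhw u h w 0 1 = w - u) *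
  (uhw u h w 1 0 = w + u) * (uhw u h w 1 1 = - h).
Proof. by rewrite !mxE /=; do !split; ring. Qed.

Lemma c_uhw u h w :
  (cU (uhw u h w) = u) * (cH (uhw u h w) = h) * (cW (uhw u h w) = w).
Proof. by rewrite /cU /cH /cW !uhwE; do !split; field. Qed.

Lemma mxtrace_uhw u h w : \tr (uhw u h w) = 0.
Proof. by rewrite mxtrace2E !uhwE subrr. Qed.

Lemma uhw_c X : \tr X = 0 -> uhw (cU X) (cH X) (cW X) = X.
Proof.
rewrite mxtrace2E => /eqP; rewrite addr_eq0 => /eqP X00.
by apply: matrix2P; rewrite uhwE /cU /cH /cW ?X00; field.
Qed.

Lemma addmxE A B i j : (A + B) i j = A i j + B i j.
Proof. by rewrite mxE. Qed.

Lemma oppmxE A i j : (- A) i j = - A i j.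
Proof. by rewrite mxE. Qed.

Lemma scalemxE (k : R) A i j : (k *: A) i j = k * A i j.
Proof. by rewrite mxE. Qed.

Lemma scalarmxE (k : R) : ((k%:M : 'M[R]_2) 0 0 = k) * ((k%:M : 'M[R]_2) 0 1 = 0)
  * ((k%:M : 'M[R]_2) 1 0 = 0) * ((k%:M : 'M[R]_2) 1 1 = k).
Proof. by rewrite !mxE. Qed.

Lemma mxUE : ((mxU : 'M[R]_2) 0 0 = 0) * ((mxU : 'M[R]_2) 0 1 = - 1)
  * ((mxU : 'M[R]_2) 1 0 = 1) * ((mxU : 'M[R]_2) 1 1 = 0).
Proof. by rewrite !mxE /=; do !split; ring. Qed.

Variable m : R.

Lemma Yfst_uhw u h w : Yfst m (uhw u h w) = uhw (- m * u) h w.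
Proof.
rewrite /Yfst /kproj /pproj -/(cU _) -/(cH _) -/(cW _) !c_uhw scalerA.
by rewrite /uhw addrA.
Qed.

Lemma Ysnd_uhw u h w : Ysnd m (uhw u h w) = ((1 + m) * u) *: mxU.
Proof. by rewrite /Ysnd /kproj -/(cU _) c_uhw scalerA. Qed.

(* The derivative of [P_m] at [(e, uU + aH)] in the direction [(0, X)],
   multiplied on the right by the inverse of the value of [P_m]. *)
Definition Qmx (u a : R) X : 'M[R[i]]_2 :=
  let Y := uhw (- m * u) a 0 in
  dexpi Y (Yfst m X) *m expi (- Y) +
  expi Y *m mkmx 0 (Ysnd m X) *m expi (- Y).

(** Im Q consists of a 2 x 2 block on the span of U and H and of the scalar C S on W. Since q s = C
    S - 1, the quantity s stands for (C S - 1)/q without a division. *)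
Lemma Qmx_uhw u a u' h w :
  let q := m ^+ 2 * u ^+ 2 - a ^+ 2 in
  let C := Cfun q in let S := Sfun q in
  let s := S ^+ 2 - 2 * C * dSfun q in
  let t := m * s - 2 * (1 + m) * S ^+ 2 in
  let mu := - m * u in
  exists2 Z, \tr Z = 0 & Qmx u a (uhw u' h w) = mkmx Z
   (uhw ((1 + a ^+ 2 * t) * u' + a * mu * s * h)
        (a * mu * t * u' + (1 + mu ^+ 2 * s) * h) (C * S * w)).
Proof.
move=> q C S s t mu; rewrite /Qmx Yfst_uhw Ysnd_uhw -/mu.
have detY : \det (uhw mu a 0) = q by rewrite det2E !uhwE /q /mu; ring.
have e1 : C ^+ 2 - q * S ^+ 2 = 1 by exact: CfunSfun_unit.
have e2 : 2 * q * dSfun q = C - S by exact: mulr_dSfun.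
(* The relations among C, S and S' are kept as polynomials equal to 0; the remaining identities hold
   modulo them. *)
have r1 : C ^+ 2 - q * S ^+ 2 - 1 = 0 by rewrite e1 subrr.
have r3 : C * S - 1 - q * s = 0.
  have -> : C * S - 1 - q * s = - (C ^+ 2 - q * S ^+ 2 - 1) * (- 1)
    - C * (C - S - 2 * q * dSfun q) by rewrite /s; ring.
  by rewrite r1 e2; ring.
have r2 : C - 2 * q * dSfun q - S = 0 by rewrite e2; ring.
have qE : q = mu ^+ 2 - a ^+ 2 by rewrite /q /mu; ring.
rewrite /dexpi /expi det2N detY -/C -/S !mulmx_mkmx add_mkmx.
rewrite !mulmx0 sub0r addr0.
have ddE : ddet (uhw mu a 0) (uhw (- m * u') h w) =
  - 2 * (mu * (m * u') + a * h) by rewrite /ddet !uhwE; ring.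
rewrite ddE {ddE detY e1 e2}.
(* C, S, S' and mu become independent variables, subject only to the three relations. *)
move: (dSfun q) @s @t r2 r3 => D s t r2 r3; clearbody C S mu; clearbody q.
rewrite {}qE in r1 r2 r3 *.
pose ent := (uhwE, addmxE, oppmxE, scalemxE, mulmx2E, scalarmxE, mxUE).
set Z := _ + _; set B := _ + _; exists Z.
  transitivity (2 * (mu * (m * u') + a * h) * S * (- 1) *
    (C - 2 * (mu ^+ 2 - a ^+ 2) * D - S)); last by rewrite r2 mulr0.
  by rewrite mxtrace2E /Z !ent; field.
(* Each entry of the difference is an explicit combination of the left-hand sides of [r1] and
   [r3]. *)
congr mkmx; rewrite /B; apply: matrix2P; rewrite !ent; apply/eqP;
  rewrite -subr_eq0; apply/eqP.
- transitivity (h * (C * S - 1 - (mu ^+ 2 - a ^+ 2) * s)).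
    by rewrite /t /s; field.
  by rewrite r3 mulr0.
- transitivity (m * u' * (C * S - 1 - (mu ^+ 2 - a ^+ 2) * s)
    - (1 + m) * u' * (C ^+ 2 - (mu ^+ 2 - a ^+ 2) * S ^+ 2 - 1)).
    by rewrite /t /s; field.
  by rewrite r3 r1; ring.
- transitivity ((1 + m) * u' * (C ^+ 2 - (mu ^+ 2 - a ^+ 2) * S ^+ 2 - 1)
    - m * u' * (C * S - 1 - (mu ^+ 2 - a ^+ 2) * s)).
    by rewrite /t /s; field.
  by rewrite r3 r1; ring.
- transitivity (- h * (C * S - 1 - (mu ^+ 2 - a ^+ 2) * s)).
    by rewrite /t /s; field.
  by rewrite r3 mulr0.
Qed.

Lemma dPmap_Qmx (u a : R) Z X :
  dPmap m (1%:M, uhw u a 0) (Z, X) =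
  (complexify Z + Qmx u a X) *m Pmap m (1%:M, uhw u a 0).
Proof.
rewrite PmapE /dPmap /Qmx /= Yfst_uhw Ysnd_uhw.
rewrite (_ : Ysnd m X = ((1 + m) * cU X) *: mxU); last first.
  by rewrite /Ysnd /kproj -/(cU _) scalerA.
rewrite complexify1.
(* The last exponent and its variation are both multiples of U, so the derivative of this factor is
   i (1 + m) X_k times the factor. *)
rewrite (dexpi_scale ((1 + m) * u) ((1 + m) * cU X) (mxtrace_mxU R)).
exact: mulmx_dproduct (expiNl (mxtrace_uhw _ _ _)).
Qed.

Lemma Pmap_inv (u a : R) : exists P' : 'M[R[i]]_2,
  Pmap m (1%:M, uhw u a 0) *m P' = 1%:M /\ P' *m Pmap m (1%:M, uhw u a 0) = 1%:M.
Proof.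
pose X := uhw u a 0.
exists (expi (- Ysnd m X) *m expi (- Yfst m X)).
have h : Pmap m (1%:M, X) *m (expi (- Ysnd m X) *m expi (- Yfst m X)) = 1%:M.
  rewrite PmapE complexify1 mul1mx.
  exact: mulmx_inv2 (expiN (mxtrace_Yfst _ _)) (expiN (mxtrace_Ysnd _ _)).
by split=> //; exact: mulmx1C.
Qed.

Lemma uhw_inj u h w u' h' w' : uhw u h w = uhw u' h' w' ->
  [/\ u = u', h = h' & w = w'].
Proof.
by move=> e; split; [rewrite -(c_uhw u h w).1.1|rewrite -(c_uhw u h w).1.2|
  rewrite -(c_uhw u h w).2]; rewrite e c_uhw.
Qed.

Lemma tangentSL21 Z : tangentSL2 1%:M Z <-> \tr Z = 0.
Proof.
split; first by move=> [W trW <-]; rewrite mul1mx.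
by move=> trZ; exists Z => //; rewrite mul1mx.
Qed.

(** * Non-singularity as a condition on the determinant of Im Q *)

Section Nonsingular.
Variables u a : R.
Let q := m ^+ 2 * u ^+ 2 - a ^+ 2.
Let C := Cfun q.
Let S := Sfun q.
Let s := S ^+ 2 - 2 * C * dSfun q.
Let t := m * s - 2 * (1 + m) * S ^+ 2.
Let mu := - m * u.
Let P := Pmap m (1%:M, uhw u a 0).

(** A kernel vector X of Im Q gives the kernel vector (- Re Q(X), X) of the differential, Re Q(X)
    being real and traceless. *)
Lemma nonsingular_kernel (u' h w : R) : nonsingular_at m (1%:M, uhw u a 0) ->
  (1 + a ^+ 2 * t) * u' + a * mu * s * h = 0 ->
  a * mu * t * u' + (1 + mu ^+ 2 * s) * h = 0 -> C * S * w = 0 ->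
  [/\ u' = 0, h = 0 & w = 0].
Proof.
rewrite /nonsingular_at diff_Pmap => -[_ inj _] e1 e2 e3.
have main v1 v2 v3 : (1 + a ^+ 2 * t) * v1 + a * mu * s * v2 = 0 ->
    a * mu * t * v1 + (1 + mu ^+ 2 * s) * v2 = 0 -> C * S * v3 = 0 ->
    exists2 Z, \tr Z = 0 & dPmap m (1%:M, uhw u a 0) (Z, uhw v1 v2 v3) = 0.
  move=> f1 f2 f3; have [Z trZ QZ] := Qmx_uhw u a v1 v2 v3.
  exists (- Z); first by rewrite mxtraceN2 trZ oppr0.
  rewrite dPmap_Qmx QZ -/q -/C -/S -/s -/t -/mu f1 f2 f3 complexify_mkmx.
  rewrite add_mkmx addNr (_ : uhw 0 0 0 = 0) ?addr0.
    by rewrite -complexify_mkmx [complexify 0]map_mx0 mul0mx.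
  by rewrite /uhw !scale0r !addr0.
have [Z1 t1 d1] := main _ _ _ e1 e2 e3.
(* Injectivity compares two tangent vectors with the same image; the second one comes from the zero
   vector. *)
have [|||Z0 t0 d0] := main 0 0 0; rewrite ?mulr0 ?addr0//.
have tan Z v1 v2 v3 : \tr Z = 0 ->
    (Z, uhw v1 v2 v3) \in tangent_Gg (1%:M, uhw u a 0).
  by move=> trZ; rewrite inE; split; [exact/tangentSL21|exact: mxtrace_uhw].
have d10 : (realify \o dPmap m (1%:M, uhw u a 0)) (Z1, uhw u' h w) =
    (realify \o dPmap m (1%:M, uhw u a 0)) (Z0, uhw 0 0 0).
  by rewrite /= d1 d0.
by have [_ /uhw_inj] := inj _ _ (tan _ _ _ _ t1) (tan _ _ _ _ t0) d10.
Qed.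

Lemma nonsingularP : nonsingular_at m (1%:M, uhw u a 0) <->
  C * S != 0 /\
  (1 + a ^+ 2 * t) * (1 + mu ^+ 2 * s) - a * mu * s * (a * mu * t) != 0.
Proof.
split=> [ns|[J1 J2]].
  split; apply/eqP => J.
    (* If C S = 0, then W lies in the kernel of Im Q. *)
    have [|||_ _ /eqP] := nonsingular_kernel (u' := 0) (h := 0) (w := 1) ns;
      by rewrite ?J ?mulr0 ?addr0 ?mul0r ?oner_eq0.
  (* If the block determinant vanishes, the columns of the adjugate lie in the kernel, so all four
     entries of the block vanish. *)
  have [|||d0 g0 _] := nonsingular_kernel (u' := 1 + mu ^+ 2 * s)
    (h := - (a * mu * t)) (w := 0) ns; rewrite ?mulr0 //; last 1 first.
  - have [|||b0 /eqP al0 _] := nonsingular_kernel (u' := a * mu * s)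
      (h := - (1 + a ^+ 2 * t)) (w := 0) ns; rewrite ?mulr0 //; last 1 first.
    (* The vanishing entries combine to a = 0, but then the first diagonal entry is 1. *)
    + have a0 : a = - (a * mu * s) * mu + a * (1 + mu ^+ 2 * s) by ring.
      move: al0; rewrite a0 b0 d0 oppr0 mul0r mulr0 addr0 expr0n mul0r addr0.
      by rewrite oppr_eq0 oner_eq0.
    + by ring.
    + by rewrite -[RHS]oppr0 -J; ring.
  - by rewrite -[RHS]J; ring.
  - by ring.
(* The value of P_m being invertible, it remains to study (Z, X) |-> Z + Q(X). *)
have [P'] := Pmap_inv u a; rewrite -/P => -[PP' P'P].
have PI (M N : 'M[R[i]]_2) : M *m P = N *m P -> M = N.
  exact: mulmx_rcancel PP'.
have trQ Z (u' h w : R) : \tr Z = 0 ->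
    \tr (complexify Z + Qmx u a (uhw u' h w)) = 0.
  move=> trZ; have [Z' trZ' ->] := Qmx_uhw u a u' h w.
  rewrite complexify_mkmx add_mkmx; apply/mxtrace_mkmx; split.
    by rewrite mxtraceD trZ trZ' addr0.
  by rewrite add0r mxtrace_uhw.
rewrite /nonsingular_at diff_Pmap; split.
- move=> [Z X] /= [/tangentSL21 trZ trX]; rewrite dPmap_Qmx.
  rewrite -(uhw_c (trX : \tr X = 0)); set N := complexify Z + _.
  exists (N *m P); last by [].
  by apply/(tangentSL2_mulmx _ PP' P'P)/trQ.
- move=> [Z1 X1] [Z2 X2]; rewrite !inE /= => -[/tangentSL21 trZ1 trX1].
  move=> [/tangentSL21 trZ2 trX2] /realify_inj; rewrite !dPmap_Qmx => /PI.
  rewrite -(uhw_c (trX1 : \tr X1 = 0)) -(uhw_c (trX2 : \tr X2 = 0)).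
  move: (cU X1) (cH X1) (cW X1) (cU X2) (cH X2) (cW X2) => u1 h1 w1 u2 h2 w2 e.
  have [Z1' _ Q1] := Qmx_uhw u a u1 h1 w1.
  have [Z2' _ Q2] := Qmx_uhw u a u2 h2 w2.
  have := congr1 (fun M => (realify M).2) e.
  rewrite Q1 Q2 !complexify_mkmx !add_mkmx !realify_mkmx /= !add0r.
  rewrite -/q -/C -/S -/s -/t -/mu => /uhw_inj[E1 E2 E3].
  have w12 : w1 = w2 by apply: (mulfI J1).
  (* Cramer's rule: the adjugate of the block recovers both coordinates up to the nonzero
     determinant. *)
  have u12 : u1 = u2.
    apply: (mulfI J2).
    transitivity ((1 + mu ^+ 2 * s) * ((1 + a ^+ 2 * t) * u1 + a * mu * s * h1)
      - a * mu * s * (a * mu * t * u1 + (1 + mu ^+ 2 * s) * h1)); first by ring.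
    by rewrite E1 E2; ring.
  have h12 : h1 = h2.
    apply: (mulfI J2).
    transitivity ((1 + a ^+ 2 * t) * (a * mu * t * u1 + (1 + mu ^+ 2 * s) * h1)
      - a * mu * t * ((1 + a ^+ 2 * t) * u1 + a * mu * s * h1)); first by ring.
    by rewrite E1 E2; ring.
  move: e; rewrite u12 h12 w12 => /addIr e; congr (_, _).
  by have := congr1 (fun M => (realify M).1) e; rewrite !complexify_mkmx !realify_mkmx.
- move=> _ [W tanW <-]; pose N := W *m P'.
  have NP : W = N *m P by rewrite /N -mulmxA P'P mulmx1.
  have trN : \tr N = 0.
    by apply/(tangentSL2_mulmx _ PP' P'P); rewrite -NP.
  set A := (realify N).1; set B := (realify N).2.
  have NE : N = mkmx A B by rewrite mkmx_realify.
  have [trA trB] : \tr A = 0 /\ \tr B = 0 by apply/mxtrace_mkmx; rewrite -NE.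
  set D := _ - _ in J2.
  (* Cramer's rule on the block and division by C S solve Im Q(X) = Im N; then Z = Re N - Re
     Q(X). *)
  pose u' := ((1 + mu ^+ 2 * s) * cU B - a * mu * s * cH B) / D.
  pose h := ((1 + a ^+ 2 * t) * cH B - a * mu * t * cU B) / D.
  pose w := cW B / (C * S).
  have [Z' trZ' QE] := Qmx_uhw u a u' h w.
  exists (A - Z', uhw u' h w).
    split; last exact: mxtrace_uhw.
    by apply/tangentSL21; rewrite /= mxtraceD trA mxtraceN2 trZ' subr0.
  rewrite /= dPmap_Qmx -/P [in RHS]NP; congr (realify (_ *m _)).
  rewrite QE complexify_mkmx add_mkmx subrK add0r NE; congr mkmx.
  rewrite -[RHS](uhw_c trB) -/q -/C -/S -/s -/t -/mu; congr uhw.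
  + rewrite /u' /h; apply: (mulfI J2); rewrite {1}/D.
    by move: J2; rewrite /D => J2'; field.
  + rewrite /u' /h; by move: J2; rewrite /D => J2'; field.
  + by rewrite /w mulrC divfK.
Qed.

(** The terms in s t cancel in the block determinant, leaving 1 + a^2 t + mu^2 s. With C S = 1 + q s
    and 8 S'(4q) = 2 S^2 - s, where C and S are taken at q, this equals S(x) - 8 (1 + m) a^2
    S'(x). *)
Lemma nonsingular_iff : let x := 4 * u ^+ 2 * m ^+ 2 - 4 * a ^+ 2 in
  nonsingular_at m (1%:M, u *: mxU + a *: mxH) <->
  Sfun x != 0 /\ Sfun x - 8 * (1 + m) * a ^+ 2 * dSfun x != 0.
Proof.
have -> : u *: mxU + a *: mxH = uhw u a 0 by rewrite /uhw scale0r addr0.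
have -> : 4 * u ^+ 2 * m ^+ 2 - 4 * a ^+ 2 = 4 * q by rewrite /q; ring.
rewrite /= Sfun_double -/C -/S.
suff -> : C * S - 8 * (1 + m) * a ^+ 2 * dSfun (4 * q) =
  (1 + a ^+ 2 * t) * (1 + mu ^+ 2 * s) - a * mu * s * (a * mu * t).
  exact: nonsingularP.
have -> : 8 * (1 + m) * a ^+ 2 * dSfun (4 * q) =
  (1 + m) * a ^+ 2 * (8 * dSfun (4 * q)) by ring.
have e1 : C ^+ 2 = q * S ^+ 2 + 1 by rewrite -(CfunSfun_unit q) addrC subrK.
have e2 : 2 * q * dSfun q = C - S := mulr_dSfun q.
have r3 : C * S = 1 + q * s.
  have -> : q * s = q * S ^+ 2 - C * (2 * q * dSfun q) by rewrite /s; ring.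
  by rewrite e2 -[q * _](addrK 1) -e1; ring.
have cd : 2 * C * dSfun q = S ^+ 2 - s by rewrite /s; ring.
rewrite dSfun_double -/C -/S r3 cd /t /mu; clear r3 cd e1 e2.
by move: s S; rewrite /q => s' S'; ring.
Qed.

End Nonsingular.

End MkMx.

(** * The connected component *)

Local Close Scope complex_scope.

Section Slice.
Variables (R : realType) (m : R).
Let V := ('M[R]_2 * 'M[R]_2)%type.

(** Like [slice_F], defined on the whole ambient space, so that its sign can be followed by
    continuity along a connected set. *)
Definition slice_x (p : V) : R := 4 * cU p.2 ^+ 2 * m ^+ 2 - 4 * cH p.2 ^+ 2.

Definition slice_F (p : V) : R :=
  Sfun (slice_x p) - 8 * (1 + m) * cH p.2 ^+ 2 * dSfun (slice_x p).

Definition slice_point (u a : R) : V := (1%:M, u *: mxU + a *: mxH).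

Lemma slice_pointE u a : slice_point u a = (1%:M, uhw u a 0).
Proof. by rewrite /slice_point /uhw scale0r addr0. Qed.

Lemma cU_slice u a : cU (slice_point u a).2 = u.
Proof. by rewrite slice_pointE c_uhw. Qed.

Lemma cH_slice u a : cH (slice_point u a).2 = a.
Proof. by rewrite slice_pointE c_uhw. Qed.

Lemma Sigma_slice (p : V) :
  Sigma p <-> exists u a : R, 0 <= a /\ p = slice_point u a.
Proof.
split=> [[p1 trX [a /= a0 ap]]|[u [a [a0 ->]]]].
  exists (cU p.2), a; split=> //; rewrite (surjective_pairing p) p1 /slice_point.
  congr (_, _); rewrite -[LHS](uhw_c trX) /uhw -addrA; congr (_ + _).
  by rewrite ap /pproj -/(cH _) -/(cW _).
rewrite slice_pointE; split=> //=; first exact: mxtrace_uhw.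
exists a => //=; rewrite /pproj -/(cH _) -/(cW _) !c_uhw.
by rewrite scale0r addr0.
Qed.

Lemma continuous_slice_x : continuous slice_x.
Proof.
move=> p.
have hU := is_diff_mul_const 2^-1 (is_diff_sub (is_diff_snd p 1 0) (is_diff_snd p 0 1)).
have hH := is_diff_mul_const 2^-1 (is_diff_sub (is_diff_snd p 0 0) (is_diff_snd p 1 1)).
have hx := is_diff_sub
  (is_diff_mul_const (m ^+ 2) (is_diff_mul (is_diff_const p 4) (is_diff_mul hU hU)))
  (is_diff_mul (is_diff_const p 4) (is_diff_mul hH hH)).
exact: (differentiable_continuous (ex_diff (is_diff_def := hx))).
Qed.

Lemma continuous_slice_F : continuous slice_F.
Proof.
move=> p.
have hH := is_diff_mul_const 2^-1 (is_diff_sub (is_diff_snd p 0 0) (is_diff_snd p 1 1)).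
have hH2 := is_diff_mul (is_diff_const p (8 * (1 + m))) (is_diff_mul hH hH).
have hx := @continuous_slice_x p.
have hS : {for slice_x p, continuous (@Sfun R)}.
  by rewrite SfunE; exact/continuous_psum/fact_bounded_Scoef.
have hdS : {for slice_x p, continuous (@dSfun R)}.
  exact/continuous_psum/fact_bounded_diffs/fact_bounded_Scoef.
have cH2 := differentiable_continuous (ex_diff (is_diff_def := hH2)).
have cS := continuous_comp hx hS; have cdS := continuous_comp hx hdS.
exact: (cvgB cS (cvgM cH2 cdS)).
Qed.

(** The image of A is an interval missing c. *)
Lemma connected_gt (T : topologicalType) (A : set T) (f : T -> R) (x y : T) c :
  connected A -> continuous f -> (forall z, A z -> f z != c) ->
  A x -> c < f x -> A y -> c < f y.
Proof.
move=> cA cf fc Ax cx Ay; rewrite ltNge le_eqVlt negb_or fc//= -leNgt.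
rewrite leNgt; apply/negP => yc.
have : connected (f @` A).
  apply: connected_continuous_connected => //.
  exact: continuous_subspaceT.
move=> /connected_intervalP /(_ (f y) (f x)).
have h1 : (f @` A) (f y) by exists y.
have h2 : (f @` A) (f x) by exists x.
move=> /(_ h1 h2 c); rewrite !ltW// => /(_ isT)[z Az zc].
by have := fc z Az; rewrite zc eqxx.
Qed.

(** x scales by t^2. If 1 + m >= 0, the monotonicity of r S'(r x) / S(r x), used at r = t^2 and r =
    1, compares the two values of [slice_F]; if 1 + m < 0, a nonnegative term is added to S > 0. *)
Lemma slice_F_scale (u a t : R) : 0 <= t <= 1 ->
  - pi ^+ 2 < slice_x (slice_point u a) -> 0 < slice_F (slice_point u a) ->
  - pi ^+ 2 < slice_x (slice_point (t * u) (t * a)) /\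
  0 < slice_F (slice_point (t * u) (t * a)).
Proof.
move=> /andP[t0 t1]; rewrite /slice_F.
have -> : slice_x (slice_point (t * u) (t * a)) =
  t ^+ 2 * slice_x (slice_point u a).
  by rewrite /slice_x !cU_slice !cH_slice; ring.
rewrite !cH_slice; set x := slice_x _ => hx h.
have tt : 0 <= t ^+ 2 <= 1 by rewrite sqr_ge0 expr_le1.
have pi2 : (0 : R) < pi ^+ 2 by rewrite exprn_gt0// pi_gt0.
have htx : - pi ^+ 2 < t ^+ 2 * x by have [x0|x0] := leP 0 x; nra.
split=> //.
have := dSfun_div_Sfun_scale hx tt.
have := Sfun_gt0 hx; have := Sfun_gt0 htx; have := dSfun_gt0 hx.
have := dSfun_gt0 htx; move: h.
move: (Sfun x) (dSfun x) (Sfun (_ * x)) (dSfun (_ * x)) => Sx Dx St Dt.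
move=> h Dt0 Dx0 St0 Sx0 le.
(* The factor S(x) > 0 brings the claim to the cross-multiplied form of the comparison. *)
suff : 0 < Sx * (St - 8 * (1 + m) * (t * a) ^+ 2 * Dt) by rewrite pmulr_rgt0.
have [m1|m1] := leP 0 (1 + m).
  have k0 : 0 <= 8 * (1 + m) * a ^+ 2 by rewrite mulr_ge0 ?sqr_ge0// mulr_ge0.
  have e1 := ler_wpM2l k0 le.
  have e2 : 0 < St * (Sx - 8 * (1 + m) * a ^+ 2 * Dx) by rewrite mulr_gt0.
  by lra.
have k0 : 0 <= 8 * (- (1 + m)) * (t * a) ^+ 2 * Dt.
  by rewrite mulr_ge0 ?(ltW Dt0)// mulr_ge0 ?sqr_ge0// mulr_ge0// oppr_ge0 ltW.
by rewrite mulr_gt0//; lra.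
Qed.

End Slice.

(** * The slice as the region cut out by the two inequalities *)

Theorem proposition4p2 (R : realType) (m : R) :
  Sigma_m m =
  [set p : 'M[R]_2 * 'M[R]_2 | exists u a : R,
     [/\ 0 <= a,
         p = (1%:M, u *: mxU + a *: mxH),
         - pi ^+ 2 < 4 * u ^+ 2 * m ^+ 2 - 4 * a ^+ 2
       & 4 * u ^+ 2 * m ^+ 2 + 4 * m * a ^+ 2
         < fCS (4 * u ^+ 2 * m ^+ 2 - 4 * a ^+ 2)]].
Proof.
have xE (u a : R) : 4 * u ^+ 2 * m ^+ 2 - 4 * a ^+ 2 = slice_x m (slice_point u a).
  by rewrite /slice_x cU_slice cH_slice.
(* The two inequalities as signs of continuous functions. *)
pose good (u a : R) := - pi ^+ 2 < slice_x m (slice_point u a) /\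
  0 < slice_F m (slice_point u a).
have goodP u a : good u a <->
  - pi ^+ 2 < 4 * u ^+ 2 * m ^+ 2 - 4 * a ^+ 2 /\
  4 * u ^+ 2 * m ^+ 2 + 4 * m * a ^+ 2
         < fCS (4 * u ^+ 2 * m ^+ 2 - 4 * a ^+ 2).
  rewrite /good /slice_F -xE cH_slice; set x := _ - 4 * a ^+ 2.
  have -> : 4 * u ^+ 2 * m ^+ 2 + 4 * m * a ^+ 2 = x + 4 * (1 + m) * a ^+ 2.
    by rewrite /x; ring.
  have e := mulr_dSfun x.
  (* As S' > 0, both sides may be multiplied by 2 S'; then C - 2 x S' = S. *)
  have E : - pi ^+ 2 < x ->
    (x + 4 * (1 + m) * a ^+ 2 < fCS x) =
    (0 < Sfun x - 8 * (1 + m) * a ^+ 2 * dSfun x).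
    move=> /dSfun_gt0 D0; rewrite /fCS derive1_Sfun ltr_pdivlMr ?mulr_gt0//.
    rewrite -subr_gt0; congr (0 < _).
    by rewrite -[Cfun x](subrK (Sfun x)) -e; ring.
  by split=> -[h1 h2]; split=> //; move: h2; rewrite E.
have nsP (u a : R) : nonsingular_at m (slice_point u a) <->
  Sfun (slice_x m (slice_point u a)) != 0 /\ slice_F m (slice_point u a) != 0.
  by rewrite /slice_F -xE cH_slice; exact: nonsingular_iff.
have p0 : (1%:M, 0) = slice_point (0 : R) 0.
  by rewrite /slice_point !scale0r addr0.
have good0 : good 0 0.
  rewrite /good /slice_F -xE cH_slice.
  have -> : 4 * 0 ^+ 2 * m ^+ 2 - 4 * 0 ^+ 2 = 0 :> R by ring.
  rewrite Sfun0 expr0n /= mulr0 mul0r subr0 ltr01.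
  by rewrite oppr_lt0 exprn_gt0 ?pi_gt0.
have good_ns u a : good u a -> nonsingular_at m (slice_point u a).
  by move=> [h1 h2]; apply/nsP; split; rewrite gt_eqF// Sfun_gt0.
rewrite /Sigma_m p0; apply/seteqP; split => p.
  move=> [B [B0 BA cB] Bp].
  have [/Sigma_slice[u [a [a0 pE]]] _] := BA _ Bp.
  suff /goodP[g1 g2] : good u a by exists u, a.
  rewrite /good -pE; split.
    (* On B the value - pi^2 is excluded, being a zero of S, so x stays above it as at the
       origin. *)
    apply: (connected_gt cB (@continuous_slice_x R m) _ B0 good0.1 Bp) => z Bz.
    have [/Sigma_slice[v [b [_ zE]]] ns] := BA _ Bz.
    apply/negP => /eqP zpi; move: ns; rewrite /= zE => /nsP[].
    by rewrite -zE zpi Sfun_Npi2 eqxx.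
  (* The second factor has no zero on B and equals 1 at the origin. *)
  apply: (connected_gt cB (@continuous_slice_F R m) _ B0 good0.2 Bp) => z Bz.
  have [/Sigma_slice[v [b [_ zE]]] ns] := BA _ Bz.
  by move: ns; rewrite /= zE => /nsP[].
move=> [u [a [a0 -> h1 h2]]].
have [g1 g2] : good u a by apply/goodP.
(* The straight segment from (e, 0) to the given point is the connected set required;
   star-shapedness keeps it in the region. *)
pose seg (t : R) : 'M[R]_2 * 'M[R]_2 := slice_point (t * u) (t * a).
exists (seg @` `[0, 1]); last by exists 1; rewrite /= ?in_itv /= ?lexx ?ler01// /seg !mul1r.
split.
- by exists 0; rewrite /= ?in_itv /= ?lexx ?ler01// /seg !mul0r.
- move=> _ [t /= t01 <-]; rewrite in_itv /= in t01; split.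
    apply/Sigma_slice; exists (t * u), (t * a); split=> //.
    by rewrite mulr_ge0//; case/andP: t01.
  apply: good_ns; exact: slice_F_scale.
- apply: connected_continuous_connected; first exact: segment_connected.
  apply: continuous_subspaceT => t.
  rewrite (_ : seg = fun t : R => (1%:M, t *: (u *: mxU + a *: mxH))).
    have hc : {for t, continuous (fun _ : R => 1%:M : 'M[R]_2)} by exact: cvg_cst.
    have hs : {for t, continuous (fun t : R => t *: (u *: mxU + a *: mxH) : 'M[R]_2)}.
      exact: scalel_continuous.
    exact: cvg_pair hc hs.
  by apply/funext => r; rewrite /seg /slice_point -!scalerA -scalerDr.
Qed.
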